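(* Let $G$ be a finitely generated group, and let $\mu$ be a symmetric, finitely supported probability measure on $G$ whose support generates $G$ and such that $\mu(e)>0$. Let $M=(\mu^{\ast n})_{n=1}^\infty$. Then the following hold. (1) If $\textup{dc}_M(G)>\frac{5}{8}$ then $G$ is abelian. (2) If $\textup{dc}_M(G)\ge\frac{1}{2}+\varepsilon$ for some $\varepsilon>0$ then the centre of $G$ has index at most $\frac{1}{\varepsilon}$ in $G$. (3) There is an absolute constant $C>0$ such that if $\textup{dc}_M(G)\ge\alpha>0$ then $G$ has a normal subgroup $\Gamma$ of index at most $\lceil\alpha^{-1}\rceil$ and a normal subgroup $H$ of cardinality at most $\exp(C\alpha^{-C})$ such that $H\subset\Gamma$ and $\Gamma/H$ is abelian.
   Context: $\mu^{\ast n}(x)$ is the probability that the random walk on $G$ with step distribution $\mu$, started at the identity, is at $x$ after $n$ steps (the $n$-fold convolution of $\mu$). For a probability measure $\nu$ on $G$, $\textup{dc}_\nu(G)=(\nu\times\nu)(\{(x,y)\in G\times G:xy=yx\})$, and for a sequence $M=(\mu_n)$ of probability measures, $\textup{dc}_M(G)=\limsup_{n\to\infty}\textup{dc}_{\mu_n}(G)$. $\mu$ symmetric means $\mu(x)=\mu(x^{-1})$ for all $x$. *)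

(* Defs.v *)
From HB Require Import structures.
From mathcomp Require Import all_boot all_order all_algebra.
From mathcomp Require Import all_classical all_reals all_analysis.
Import Order.TTheory GRing.Theory Num.Theory.

Set Implicit Arguments.
Unset Strict Implicit.
Unset Printing Implicit Defensive.

(* Groups: mathcomp's (possibly infinite) [groupType] from boot/monoid.v.
   Probability measures with finite support: functions [mu : G -> R] together
   with the (duplicate-free) list [s] of the points of their support. *)

Section Defs.
Variables (R : realType) (G : groupType).
Local Open Scope ring_scope.

(* mu^{*n}(x): probability that the mu-random walk from 1 is at x after n
   steps; s is a list containing the support of mu (duplicate-free). *)
Fixpoint conv_pow (mu : G -> R) (s : seq G) (n : nat) : G -> R :=
  match n with
  | 0 => fun x => (x == 1%g)%:R
  | n'.+1 => fun x => \sum_(y <- s) mu y * conv_pow mu s n' (y^-1 * x)%g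
  end.

Fixpoint walk_supp (s : seq G) (n : nat) : seq G :=
  match n with
  | 0 => [:: 1%g]
  | n'.+1 => undup [seq (y * z)%g | y <- s, z <- walk_supp s n']
  end.

(* dc_nu(G) = (nu x nu){(x,y) : xy = yx}, for nu supported in the
   duplicate-free list t *)
Definition dc_on (nu : G -> R) (t : seq G) : R :=
  \sum_(x <- t) \sum_(y <- t) (if (x * y == y * x)%g then nu x * nu y else 0).

Definition dc_walk (mu : G -> R) (s : seq G) (n : nat) : R :=
  dc_on (conv_pow mu s n) (walk_supp s n).

Definition dc_M (mu : G -> R) (s : seq G) : R :=
  limn_sup (fun n => dc_walk mu s n.+1).

End Defs.

Section GroupDefs.
Variable G : groupType.
Local Open Scope group_scope.

Inductive generated (S : G -> Prop) : G -> Prop :=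
| gen_one : generated S 1
| gen_in x : S x -> generated S x
| gen_mul x y : generated S x -> generated S y -> generated S (x * y)
| gen_inv x : generated S x -> generated S x^-1.

Definition is_subgroup (H : G -> Prop) : Prop :=
  [/\ H 1, (forall x y, H x -> H y -> H (x * y)) & (forall x, H x -> H x^-1)].

Definition is_normal (H : G -> Prop) : Prop :=
  is_subgroup H /\ (forall x g, H x -> H (g^-1 * x * g)).

Definition centre : G -> Prop := fun z => forall g, z * g = g * z.

Definition index_le (H : G -> Prop) (m : nat) : Prop :=
  exists r : seq G, (size r <= m)%N /\ forall g, exists2 a, a \in r & H (a^-1 * g).

End GroupDefs.

(* Main.v *)
(* Idea.  If dc of the n-th step law is at least alpha, many elements have a
   centraliser that is not too small for that law.  The law of the walk sees the
   index of subgroups uniformly: writing f_n(x) for the probability of the coset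
   xH, the squared norms of the f_n on G/H decrease within [0, 1], so at some
   time j bounded independently of H the function f_j is almost invariant under
   the generators; since the Schreier graph of G/H is connected and f_j has total
   mass 1, sup f_j <= 1/m + o(1) when H has index at least m, and sup f_n only
   decreases afterwards.  Centralisers of non-central elements have index at
   least 2, which gives (1) and (2).

   For (3) let A = ceil(1/alpha).  The set X of elements with at most
   4A(A+1) conjugates has measure more than 1/(A+1).  Let Z be the centraliser of
   a large finite part of X.  Then XZ lies in the set Y of elements with at most
   k = O(A^3) conjugates, and disjoint translates of XZ are few, so every element
   of Gam = <Y> is a product of O(A) elements of Y, hence has at most n = k^O(A)
   conjugates.  As in B. H. Neumann's theorem, Gam' is then contained in a
   subgroup generated by poly(A) commutators [y, g] with y in Y: modulo it, Gam is
   central.  These commutators have order at most (kn)^2 by transfer, so the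
   collection argument of Dietzmann bounds Gam' by exp(poly(A)). *)

Require Import Defs.
From HB Require Import structures.
From mathcomp Require Import all_boot all_order all_algebra.
From mathcomp Require Import all_classical all_reals all_analysis.
From mathcomp Require Import ring lra zify.
Import Order.TTheory GRing.Theory Num.Theory.

Set Implicit Arguments.
Unset Strict Implicit.
Unset Printing Implicit Defensive.

(** * Relative index, centralisers and elements with few conjugates *)

Section RelativeIndex.
Variable G : groupType.
Implicit Types (L H K : G -> Prop) (l r : seq G).
Local Open Scope group_scope.

(** Boolean-valued, so that families of elements in distinct left cosets are [pairwise] lists. *)
Definition noncong H : rel G := fun x y => `[< ~ H (x^-1 * y) >].
Arguments noncong : simpl never.

(* [idx L H m] bounds by [m] the number of left cosets of [H] that meet [L] *)
Definition idx L H (m : nat) : Prop :=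
  forall l, (forall x, x \in l -> L x) -> pairwise (noncong H) l ->
  (size l <= m)%N.

Definition full : G -> Prop := fun=> True.

Lemma noncong_sym H : is_subgroup H -> symmetric (noncong H).
Proof.
move=> [_ _ HV] x y; apply/asboolP/asboolP => h /HV;
  by rewrite invgM invgK.
Qed.

Lemma noncong_trans H x y z : is_subgroup H ->
  H (x^-1 * y) -> H (x^-1 * z) -> H (y^-1 * z).
Proof.
move=> [_ HM HV] /HV hxy hxz; have := HM _ _ hxy hxz.
by rewrite invgM invgK -mulgA mulVKg.
Qed.

Lemma pairwise_mem (T : eqType) (e : rel T) (s : seq T) x y : symmetric e ->
  pairwise e s -> x \in s -> y \in s -> x != y -> e x y.
Proof.
move=> se; elim: s => //= z s IH /andP[/allP hz /IH{}IH].
rewrite !inE => /predU1P[->|xs] /predU1P[->|ys]; rewrite ?eqxx //.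
- by move=> _; apply: hz.
- by move=> _; rewrite se; apply: hz.
- exact: IH.
Qed.

(** Pigeonhole: members of [s] are pairwise related by [e], so the last hypothesis makes their
    images distinct. *)
Lemma pairwise_size (T : eqType) (U : eqType) (e : rel T) (s : seq T)
    (t : seq U) (f : T -> U) : pairwise e s ->
  {in s, forall x, f x \in t} ->
  {in s &, forall x y, f x = f y -> ~~ e x y} -> (size s <= size t)%N.
Proof.
move=> es fs fi; rewrite -(size_map f); apply: uniq_leq_size; last first.
  by move=> _ /mapP[x xs ->]; apply: fs.
rewrite uniq_pairwise pairwise_map.
have -> : pairwise (relpre f [rel x y | x != y]) s =
   pairwise (fun x y => f x != f y) s by [].
apply: (@sub_in_pairwise _ (mem s) e) es; last exact/allP.
by move=> x y xs ys; apply: contraTN => /eqP; apply: fi.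
Qed.

(** A pairwise incongruent list in [L] of maximal length is a transversal, since an element missed
    by all its cosets could be added to it. *)
Lemma idx_reps L H m : is_subgroup H -> idx L H m ->
  exists r, [/\ forall x, x \in r -> L x, pairwise (noncong H) r,
    forall g, L g -> exists2 a, a \in r & H (a^-1 * g),
    idx L H (size r) & (size r <= m)%N].
Proof.
move=> sH iLH.
pose P n := `[< exists l, [/\ forall x, x \in l -> L x,
                              pairwise (noncong H) l & size l = n] >].
have P0 : exists n, P n by exists 0%N; apply/asboolP; exists [::].
have Pm n : P n -> (n <= m)%N.
  by move=> /asboolP[l [lL pl <-]]; apply: iLH.
case: (ex_maxnP P0 Pm) => n /asboolP[r [rL pr sr]] nmax.
exists r; split => //.
- move=> g Lg; apply: contrapT => h.
  have : P (size (g :: r)).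
    apply/asboolP; exists (g :: r); split => //.
      by move=> x; rewrite inE => /predU1P[->//|/rL].
    rewrite /= pr andbT; apply/allP => a ar.
    by rewrite noncong_sym//; apply/asboolP => ?; apply: h; exists a.
  by move=> /nmax; rewrite /= sr ltnn.
- by move=> l lL pl; rewrite sr; apply: nmax; apply/asboolP; exists l.
- by apply: iLH.
Qed.

Lemma cover_idx L H r m : is_subgroup H -> (size r <= m)%N ->
  (forall g, L g -> exists2 a, a \in r & H (a^-1 * g)) -> idx L H m.
Proof.
move=> sH rm cov l lL pl; apply: leq_trans rm.
have /choice[f Hf] : forall g, exists a, L g -> a \in r /\ H (a^-1 * g).
  move=> g; have [Lg|] := pselect (L g); last by exists 1.
  by have [a ar Ha] := cov g Lg; exists a.
apply: (@pairwise_size _ _ _ _ _ f pl) => [x /lL/Hf[]//|x y /lL Lx /lL Ly fxy].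
have [_ Hx] := Hf _ Lx; have [_ Hy] := Hf _ Ly; rewrite -fxy in Hy.
by apply/negP => /asboolP; apply; exact: noncong_trans Hx Hy.
Qed.

Lemma index_leP H m : is_subgroup H -> index_le H m <-> idx full H m.
Proof.
move=> sH; split=> [[r [rm cov]]|/(idx_reps sH)[r [_ _ cov _ rm]]].
  by apply: (cover_idx sH rm) => g _; apply: cov.
by exists r; split=> // g; apply: cov.
Qed.

Lemma idx_sub L L' H H' m m' : (forall x, L' x -> L x) ->
  (forall x, H x -> H' x) -> (m <= m')%N -> idx L H m -> idx L' H' m'.
Proof.
move=> sL sH lem i l lL pl; apply: leq_trans lem; apply: i => [x /lL/sL//|].
apply: sub_pairwise pl => x y /asboolP h; apply/asboolP => /sH; exact: h.
Qed.

Lemma subgroupI H K : is_subgroup H -> is_subgroup K ->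
  is_subgroup (fun g => H g /\ K g).
Proof.
move=> [H1 HM HV] [K1 KM KV]; split => //.
  by move=> x y [? ?] [? ?]; split; [apply: HM|apply: KM].
by move=> x [? ?]; split; [apply: HV|apply: KV].
Qed.

(** A coset of the intersection is determined by the pair of cosets of [H] and [K] containing it. *)
Lemma idxI L H K a b : is_subgroup H -> is_subgroup K ->
  idx L H a -> idx L K b -> idx L (fun g => H g /\ K g) (a * b)%N.
Proof.
move=> sH sK /(idx_reps sH)[r [_ _ cr _ ra]] /(idx_reps sK)[t [_ _ ct _ tb]].
have /choice[f Hf] : forall g, exists a, L g -> a \in r /\ H (a^-1 * g).
  move=> g; have [Lg|] := pselect (L g); last by exists 1.
  by have [c ? ?] := cr g Lg; exists c.
have /choice[h Hh] : forall g, exists a, L g -> a \in t /\ K (a^-1 * g).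
  move=> g; have [Lg|] := pselect (L g); last by exists 1.
  by have [c ? ?] := ct g Lg; exists c.
move=> l lL pl; apply: (@leq_trans (size [seq (x, y) | x <- r, y <- t])).
  apply: (@pairwise_size _ _ _ _ _ (fun g => (f g, h g)) pl) => [x /lL Lx|].
    have [? _] := Hf _ Lx; have [? _] := Hh _ Lx.
    by apply/allpairsP; exists (f x, h x).
  move=> x y /lL Lx /lL Ly [fxy hxy].
  have [_ Hx] := Hf _ Lx; have [_ Hy] := Hf _ Ly.
  have [_ Kx] := Hh _ Lx; have [_ Ky] := Hh _ Ly.
  rewrite -fxy in Hy; rewrite -hxy in Ky.
  apply/negP => /asboolP; apply; split.
    exact: noncong_trans Hx Hy.
  exact: noncong_trans Kx Ky.
by rewrite size_allpairs leq_mul.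
Qed.

Definition cent x : G -> Prop := fun g => x * g = g * x.

Definition centl l : G -> Prop := fun g => forall x, x \in l -> cent x g.

Lemma cent_subgroup x : is_subgroup (cent x).
Proof.
split; rewrite /cent.
- by rewrite mulg1 mul1g.
- by move=> a b ha hb; rewrite mulgA ha -mulgA hb mulgA.
- by move=> a ha; apply: (mulgI a); rewrite mulgA -ha mulgK mulVKg.
Qed.

Lemma centl_subgroup l : is_subgroup (centl l).
Proof.
split=> [x _|a b ha hb x xl|a ha x xl];
  have [C1 CM CV] := cent_subgroup x => //.
  by apply: CM; [apply: ha|apply: hb].
by apply: CV; apply: ha.
Qed.

Lemma idx_centl L l k : (forall x, x \in l -> idx L (cent x) k) ->
  idx L (centl l) (k ^ size l)%N.
Proof.
elim: l => [_|x l IH hl] /=.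
  by apply: (cover_idx (centl_subgroup [::]) (r := [:: 1])) => // g _; exists 1;
    rewrite ?inE.
rewrite expnS.
have /(idxI (cent_subgroup x) (centl_subgroup l)): idx L (cent x) k.
  by apply: hl; rewrite inE eqxx.
move=> /(_ (k ^ size l)%N (IH _)) h; apply: idx_sub (h _) => //.
  by move=> g [gx gl] y; rewrite inE => /predU1P[->|/gl].
by move=> y yl; apply: hl; rewrite inE yl orbT.
Qed.

Lemma centM x y g : cent x g -> cent y g -> cent (x * y) g.
Proof. by rewrite /cent => hx hy; rewrite -mulgA hy !mulgA hx. Qed.

Lemma centV x g : cent x g -> cent x^-1 g.
Proof. by rewrite /cent => hx; apply: (mulgI x); rewrite mulVKg mulgA hx mulgK. Qed.

Lemma cent_sym x y : cent x y -> cent y x.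
Proof. by []. Qed.

(** Conjugates of [x] correspond to cosets of its centraliser, so these are the elements with at
    most [k] conjugates. *)
Definition fcc k : G -> Prop := fun x => idx full (cent x) k.

Lemma fccM x y a b : fcc a x -> fcc b y -> fcc (a * b)%N (x * y).
Proof.
move=> hx hy; apply: idx_sub (idxI (cent_subgroup x) (cent_subgroup y) hx hy) => //.
by move=> g []; apply: centM.
Qed.

Lemma fccV x a : fcc a x -> fcc a x^-1.
Proof. by apply: idx_sub => // g; apply: centV. Qed.

Lemma fccJ x g a : fcc a x -> fcc a (x ^ g).
Proof.
(* The centraliser of [x ^ g] is the conjugate by [g] of that of [x], so right multiplication by
   [g^-1] keeps representatives incongruent. *)
move=> h l _ pl; rewrite -(size_map (fun u => u * g^-1)); apply: h => //.
rewrite pairwise_map; apply: sub_pairwise pl => u v /asboolP huv.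
apply/asboolP => c; apply: huv.
have -> : u^-1 * v = ((u * g^-1)^-1 * (v * g^-1)) ^ g.
  by rewrite /conjg invgM invgK !mulgA mulVg mul1g mulgVK.
by rewrite /cent -!conjMg c.
Qed.

Lemma generated_subgroup (S : G -> Prop) : is_subgroup (generated S).
Proof. by split; [exact: gen_one|exact: gen_mul|exact: gen_inv]. Qed.

Lemma generated_min (S : G -> Prop) H : is_subgroup H ->
  (forall x, S x -> H x) -> forall x, generated S x -> H x.
Proof.
move=> [H1 HM HV] SH x; elim=> [|y|y z _ hy _ hz|y _ hy].
- exact: H1.
- exact: SH.
- exact: HM.
- exact: HV.
Qed.

Lemma subgroup_prod H l : is_subgroup H -> (forall x, x \in l -> H x) ->
  H (\prod_(x <- l) x).
Proof.
move=> [H1 HM HV]; elim: l => [|x l IH] h; first by rewrite big_nil.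
rewrite big_cons; apply: HM; first by apply: h; rewrite inE eqxx.
by apply: IH => y yl; apply: h; rewrite inE yl orbT.
Qed.

Lemma subgroupX H x n : is_subgroup H -> H x -> H (x ^+ n).
Proof. by move=> [H1 HM HV] hx; elim: n => // n IH; rewrite expgS; apply: HM. Qed.

Lemma subgroupR H x y : is_subgroup H -> H x -> H y -> H [~ x, y].
Proof.
move=> [H1 HM HV] hx hy; rewrite /commg /conjg.
exact: HM (HV _ hx) (HM _ _ (HV _ hy) (HM _ _ hx hy)).
Qed.
End RelativeIndex.

(** * Transfer to a central subgroup of finite index *)

Section Transfer.
Variable G : groupType.
Local Open Scope group_scope.

Lemma perm_prodg (l1 l2 : seq G) : perm_eq l1 l2 ->
  {in l1 &, forall x y, commute x y} ->
  \prod_(x <- l1) x = \prod_(x <- l2) x.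
Proof.
move=> p12 c1.
(* [catCA_perm_subst] asks for invariance under exchanges of arbitrary blocks; the default value 1
   covers lists with letters outside [l1], where nothing is known to commute. *)
pose F (s : seq G) := if all (mem l1) s then \prod_(x <- s) x else 1.
have -> : \prod_(x <- l1) x = F l1 by rewrite /F; case: allP => // [[]].
have -> : \prod_(x <- l2) x = F l2.
  by rewrite /F -(perm_all _ p12); case: allP => // [[]].
apply: catCA_perm_subst p12 => s1 s2 s3; rewrite /F !all_cat.
rewrite andbA [all _ s1 && _]andbC -andbA.
case: ifP => // /and3P[/allP h2 /allP h1 _].
rewrite !big_cat /= !mulgA; congr (_ * _).
have c x : x \in s2 -> commute x (\prod_(y <- s1) y).
  move=> xs2; rewrite big_seq; apply: commute_prod => y ys1.
  by apply: c1; [apply: h2|apply: h1].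
suff: commute (\prod_(y <- s1) y) (\prod_(x <- s2) x) by [].
rewrite [\prod_(x <- s2) x]big_seq; apply: commute_prod => x xs2.
exact/commute_sym/c.
Qed.

(* The transfer homomorphism [tau : L -> Z] kills commutators and sends a
   central element [z] to [z ^+ q], where [q] is the index of [Z]. *)
Lemma commg_order (L Z : G -> Prop) (M : nat) (x y : G) :
  is_subgroup L -> is_subgroup Z -> (forall z, Z z -> L z) ->
  (forall z g, Z z -> L g -> commute z g) -> idx L Z M -> L x -> L y ->
  exists2 e, (0 < e <= M * M)%N & [~ x, y] ^+ e = 1.
Proof.
move=> sL sZ ZL cZ iLZ Lx Ly.
have [L1 LM LV] := sL; have [Z1 ZM ZV] := sZ.
have [r [rL pr cov iq qM]] := idx_reps sZ iLZ.
have /choice[rho Hrho] : forall g, exists a, L g -> a \in r /\ Z (a^-1 * g).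
  move=> g; have [Lg|] := pselect (L g); last by exists 1.
  by have [c ? ?] := cov g Lg; exists c.
have rho_eq g a : L g -> a \in r -> Z (a^-1 * g) -> rho g = a.
  move=> Lg ar Za; have [rr Zr] := Hrho g Lg.
  apply/eqP/negPn/negP => ne.
  have /asboolP := pairwise_mem (noncong_sym sZ) pr rr ar ne; apply.
  have sV u v : Z (u^-1 * v) -> Z (v^-1 * u).
    by move=> /ZV; rewrite invgM invgK.
  exact: noncong_trans sZ (sV _ _ Zr) (sV _ _ Za).
(* [zeta g a] is the [Z]-part of [g * a] relative to the transversal [r]; the product of these parts
   is the transfer. *)
pose zeta g a := (rho (g * a))^-1 * (g * a).
have zetaZ g a : L g -> a \in r -> Z (zeta g a).
  by move=> Lg ar; have [] := Hrho (g * a) (LM _ _ Lg (rL _ ar)).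
pose tau g := \prod_(a <- r) zeta g a.
have ur : uniq r.
  rewrite uniq_pairwise; apply: sub_pairwise pr => u v /= /asboolP.
  by apply: contra_notN => /eqP ->; rewrite mulVg.
have prho g : L g -> perm_eq [seq rho (g * a) | a <- r] r.
  move=> Lg; have sub : {subset [seq rho (g * a) | a <- r] <= r}.
    by move=> _ /mapP[a ar ->]; have [] := Hrho (g * a) (LM _ _ Lg (rL _ ar)).
  have inj : {in r &, injective (fun a => rho (g * a))}.
    move=> a b ar br e; apply/eqP/negPn/negP => ne.
    have /asboolP := pairwise_mem (noncong_sym sZ) pr ar br ne; apply.
    have [_ Za] := Hrho (g * a) (LM _ _ Lg (rL _ ar)).
    have [_ Zb] := Hrho (g * b) (LM _ _ Lg (rL _ br)).
    move: (ZM _ _ (ZV _ Za) Zb); rewrite e !invgM !invgK.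
    by rewrite !mulgA mulgK mulgVK.
  have um : uniq [seq rho (g * a) | a <- r] by rewrite map_inj_in_uniq.
  have [_ eqr] := uniq_min_size um sub (eq_leq (esym (size_map _ _))).
  exact: uniq_perm.
have tauZ g : L g -> Z (tau g).
  move=> Lg; rewrite /tau -[\prod_(_ <- _) _](big_map (zeta g) xpredT id).
  by apply: subgroup_prod => // _ /mapP[a ar ->]; apply: zetaZ.
have tauM g h : L g -> L h -> tau (g * h) = tau g * tau h.
  (* The factors are central, so they may be reindexed by the permutation that [h] induces on the
     cosets; the cocycle identity for [zeta] then applies factor by factor. *)
  move=> Lg Lh; have -> : tau g = \prod_(a <- r) zeta g (rho (h * a)).
    rewrite -(big_map (fun a => rho (h * a)) xpredT (zeta g)).
    rewrite /tau -(big_map (zeta g) xpredT id) -[RHS](big_map (zeta g) xpredT id).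
    apply: perm_prodg; first by rewrite perm_map// perm_sym prho.
    move=> _ _ /mapP[a ar ->] /mapP[b br ->].
    by apply: cZ (zetaZ _ _ Lg ar) _; apply/ZL/zetaZ.
  rewrite /tau [LHS]big_seq [X in _ = X * _]big_seq [X in _ = _ * X]big_seq.
  rewrite -prodgM_commute; last first.
    move=> a b ar br.
    have [rr _] := Hrho (h * a) (LM _ _ Lh (rL _ ar)).
    by apply: cZ (zetaZ _ _ Lg rr) _; apply/ZL/zetaZ.
  apply: eq_bigr => a ar.
  have Lha := LM _ _ Lh (rL _ ar).
  have [rr Zb] := Hrho _ Lha; set b := rho (h * a) in rr Zb *.
  have Lgb := LM _ _ Lg (rL _ rr).
  have [rr' Zb'] := Hrho _ Lgb.
  have -> : zeta (g * h) a = (rho (g * b))^-1 * (g * h * a).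
    rewrite /zeta; congr (_^-1 * _); apply: rho_eq => //.
      exact: LM (LM _ _ Lg Lh) (rL _ ar).
    by have := ZM _ _ Zb' Zb; rewrite !mulgA mulgK.
  by rewrite /zeta -/b !mulgA mulgK.
have tau1 : tau 1 = 1.
  by apply: (mulgI (tau 1)); rewrite -tauM// !mulg1.
have tauR : tau [~ x, y] = 1.
  have LVx := LV _ Lx; have LVy := LV _ Ly; have Lxy := LM _ _ Lx Ly.
  rewrite /commg /conjg !tauM//; last by apply: LM.
  rewrite (cZ _ _ (tauZ _ Lx) (ZL _ (tauZ _ Ly))).
  rewrite [tau y^-1 * _]mulgA -tauM// mulVg tau1 mul1g -tauM// mulVg.
  exact: tau1.
have tauX c n : L c -> tau (c ^+ n) = tau c ^+ n.
  move=> Lc; elim: n => [|n IH]; first by rewrite !expg0.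
  by rewrite !expgS tauM ?IH//; apply: subgroupX.
have tau_central z : Z z -> tau z = z ^+ size r.
  move=> Zz; rewrite /tau big_seq (eq_bigr (fun=> z)); last first.
    move=> a ar; rewrite /zeta (rho_eq (z * a) a)//; last 2 first.
    - by apply: LM; [apply: ZL|apply: rL].
    - by rewrite (cZ _ _ Zz (rL _ ar)) mulKg.
    by rewrite (cZ _ _ Zz (rL _ ar)) mulKg.
  rewrite -big_seq big_const_seq count_predT.
  by elim: (size r) => //= n ->; rewrite expgS.
set c := [~ x, y]; have Lc : L c by apply: subgroupR.
(* With [q = size r], two of the [q + 1] powers [c ^+ 0], ..., [c ^+ q] lie in one coset of [Z]. *)
have [j j0 Zj] : exists2 j, (0 < j <= size r)%N & Z (c ^+ j).
  apply: contrapT => h.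
  have : (size [seq c ^+ i | i <- iota 0 (size r).+1] <= size r)%N.
    apply: iq; first by move=> _ /mapP[i _ ->]; apply: subgroupX.
    rewrite pairwise_map.
    have : pairwise ltn (iota 0 (size r).+1).
      by rewrite -sorted_pairwise ?iota_ltn_sorted//; apply: ltn_trans.
    apply: (@sub_in_pairwise _ [pred i | (i <= size r)%N]); last first.
      by apply/allP => i; rewrite mem_iota add0n ltnS.
    move=> i k; rewrite !inE => _ kr ik Zik; apply: h; exists (k - i)%N.
      by rewrite subn_gt0 (ik : (i < k)%N) (leq_trans (leq_subr _ _)).
    by move: Zik; rewrite -{1}(subnKC (ltnW ik)) expgnDr mulKg.
  by rewrite size_map size_iota ltnn.
(* The transfer of [c ^+ j] is [c ^+ (j * size r)] because [c ^+ j] is in [Z], and it is 1 because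
   [c] is a commutator. *)
exists (j * size r)%N.
  case/andP: j0 => j0 jr; rewrite muln_gt0 j0 (leq_trans j0 jr) /=.
  by rewrite leq_mul// (leq_trans jr).
by rewrite expgnA -tau_central// tauX// tauR expg1n.
Qed.
End Transfer.

(** * Dietzmann's lemma with an explicit bound *)

Section Dietzmann.
Variable G : groupType.
Local Open Scope group_scope.

Fixpoint ordered (S : seq G) : G -> Prop :=
  if S is s :: S' then
    fun g => exists a g', ordered S' g' /\ g = s ^+ a * g'
  else fun g => g = 1.

(** A leading position 0 raises the exponent of the head by one; once none is left, all positions
    drop by one and the word is over the tail. *)
Lemma sorted_ordered (S : seq G) (w : seq nat) : sorted leq w ->
  all (gtn (size S)) w -> ordered S (\prod_(i <- w) nth 1 S i).
Proof.
elim: S w => [|s S IHS] w.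
  by case: w => //= _ _; rewrite big_nil.
elim: w => [_ _|[|i] w IHw sw].
- rewrite big_nil; exists 0%N, 1; split; last by rewrite expg0 mulg1.
  by have := IHS [::] isT isT; rewrite big_nil.
- move=> /= aw; have [a [g' [og' e]]] := IHw (path_sorted sw) aw.
  exists a.+1, g'; split => //; rewrite big_cons /= e expgS mulgA//.
- move=> /= aw; exists 0%N, (\prod_(i <- i.+1 :: w) (s :: S)`_i).
  rewrite expg0 mul1g; split => //.
  have pos : all (leq 1) (i.+1 :: w).
    apply/allP => k; rewrite inE => /predU1P[->//|kw].
    have := order_path_min leq_trans sw; move=> /allP/(_ _ kw).
    exact: leq_trans.
  have -> : i.+1 :: w = [seq k.+1 | k <- [seq k.-1 | k <- i.+1 :: w]].
    rewrite -map_comp -[LHS]map_id; apply/eq_in_map => k kw /=.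
    by rewrite prednK//; move/allP: pos; apply.
  rewrite big_map; apply: IHS.
    rewrite sorted_map; apply: sub_sorted sw => u v uv /=.
    by rewrite -!subn1 leq_sub2r.
  rewrite all_map; apply/allP => k kw /=.
  have := allP pos _ kw; have : all (gtn (size S).+1) (i.+1 :: w) by [].
  by move=> /allP/(_ _ kw) /=; case: k {kw}.
Qed.

(* Collecting: moving the smallest letter to the front conjugates the letters
   it passes, which keeps them in [S] and does not change the word length. *)
Lemma sort_word (S : seq G) (w : seq nat) :
  {in S &, forall x y, x ^ y \in S} -> all (gtn (size S)) w ->
  exists w', [/\ size w' = size w, sorted leq w', all (gtn (size S)) w' &
    \prod_(i <- w') S`_i = \prod_(i <- w) S`_i].
Proof.
move=> SJ; move: {2}(size w) (erefl (size w)) => n.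
elim: n w => [|n IHn] [|i w] //=; first by exists [::].
move=> [] sw; elim/ltn_ind: i w sw => i IHi w sw /andP[iS aw].
have [[|j w'] [sw' so aw' pw']] := IHn w sw aw.
  exists [:: i]; rewrite /= iS; split => //; first by rewrite -sw'.
  by rewrite big_cons pw' big_cons.
have [ij|ji] := leqP i j.
  exists [:: i, j & w']; split => //=; rewrite ?ij ?iS//.
  - by rewrite -sw'.
  - by rewrite big_cons pw' big_cons.
move: aw' => /= /andP[jS aw'].
(* The identity [x * y = y * x ^ y] puts the smaller letter [j] in front and turns letter [i] into
   letter [k]; the inner induction on the first letter then finishes. *)
pose k := index (S`_i ^ S`_j) S.
have kS : S`_i ^ S`_j \in S by apply: SJ; apply: mem_nth.
have kk : (k < size S)%N by rewrite index_mem.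
have [||w2 [sw2 so2 aw2 pw2]] := IHi j ji (k :: w').
- by rewrite -sw -sw'.
- by rewrite /= kk jS.
exists w2; split => //; first by rewrite sw2 /= -sw'.
rewrite pw2 !big_cons -pw' big_cons nth_index//.
by rewrite !mulgA mulgV mul1g.
Qed.

Lemma ordered_list (S : seq G) (E : nat) :
  (forall s, s \in S -> exists2 e, (0 < e <= E)%N & s ^+ e = 1) ->
  exists t, (size t <= E ^ size S)%N /\ forall g, ordered S g -> g \in t.
Proof.
elim: S => [_|s S IH hS] /=.
  by exists [:: 1]; split => // g ->; rewrite inE.
have [|t [st ht]] := IH; first by move=> x xS; apply: hS; rewrite inE xS orbT.
exists [seq s ^+ a * g | a <- iota 0 E, g <- t]; split.
  by rewrite size_allpairs size_iota expnS leq_mul2l st orbT.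
move=> _ [a [g' [/ht g't ->]]].
have [e /andP[e0 eE] se] : exists2 e, (0 < e <= E)%N & s ^+ e = 1.
  by apply: hS; rewrite inE eqxx.
apply/allpairsP; exists ((a %% e)%N, g'); split => //=.
  by rewrite mem_iota /= add0n (leq_trans _ eE)// ltn_mod.
by rewrite {1}(divn_eq a e) expgnDr mulnC expgnA se expg1n mul1g.
Qed.

(** Finite orders turn inverses into positive powers, so every element is a positive word;
    collecting it leaves one exponent below [E] for each member of [S]. *)
Lemma dietzmann (S : seq G) (E : nat) :
  {in S &, forall x y, x ^ y \in S} ->
  (forall s, s \in S -> exists2 e, (0 < e <= E)%N & s ^+ e = 1) ->
  exists t, (size t <= E ^ size S)%N /\
    forall g, generated (fun x => x \in S) g -> g \in t.
Proof.
move=> SJ hS; have [t [st ht]] := ordered_list hS.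
exists t; split => // g Sg.
have [w aw ->] : exists2 w, all (gtn (size S)) w & g = \prod_(i <- w) S`_i.
  suff [w wS ->] : exists2 w, {subset w <= S} & g = \prod_(x <- w) x.
    exists [seq index x S | x <- w].
      by rewrite all_map; apply/allP => x /wS /=; rewrite index_mem.
    rewrite big_map [LHS]big_seq [RHS]big_seq; apply: eq_bigr => x /wS xS.
    by rewrite nth_index.
  elim: Sg => [|x xS|x y _ [u uS ->] _ [v vS ->]|x _ [u uS ->]].
  - by exists [::]; rewrite ?big_nil.
  - by exists [:: x]; [move=> z; rewrite inE => /eqP->|rewrite big_seq1].
  - exists (u ++ v); rewrite ?big_cat// => z.
    by rewrite mem_cat => /orP[/uS|/vS].
  elim: u uS => [|x' u IH] uS; first by exists [::]; rewrite ?big_nil// invg1.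
  have xS : x' \in S by apply: uS; rewrite inE eqxx.
  have [|v vS e] := IH; first by move=> z zu; apply: uS; rewrite inE zu orbT.
  have [n /andP[n0 _] xn] := hS _ xS.
  exists (v ++ nseq n.-1 x').
    move=> z; rewrite mem_cat => /orP[/vS//|].
    by rewrite mem_nseq => /andP[_ /eqP->].
  rewrite big_cons big_cat /= invgM e; congr (_ * _).
  have -> : \prod_(i <- nseq n.-1 x') i = x' ^+ n.-1.
    elim: (n.-1) => [|m IHm]; first by rewrite big_nil expg0.
    by rewrite big_cons IHm expgS.
  by apply/mulg1_eq; rewrite -expgS prednK.
have [w' [_ so aw' <-]] := sort_word SJ aw.
exact/ht/sorted_ordered.
Qed.
End Dietzmann.

(** * Word length and bounded generation *)

Section Words.
Variable G : groupType.
Local Open Scope group_scope.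

Definition word (Y : G -> Prop) m g := exists w : seq G,
  [/\ (size w <= m)%N, forall y, y \in w -> Y y & g = (\prod_(y <- w) y)%g].

Lemma word_mul (Y : G -> Prop) a b x y :
  word Y a x -> word Y b y -> word Y (a + b) (x * y)%g.
Proof.
move=> [u [ua uY ->]] [v [vb vY ->]]; exists (u ++ v); split.
- by rewrite size_cat leq_add.
- by move=> z; rewrite mem_cat => /orP[/uY|/vY].
- by rewrite big_cat.
Qed.

Lemma word_le (Y : G -> Prop) a b x : (a <= b)%N -> word Y a x -> word Y b x.
Proof. by move=> ab [w [wa wY ->]]; exists w; split=> //; apply: leq_trans ab. Qed.

Lemma word1 (Y : G -> Prop) y : Y y -> word Y 1 y.
Proof.
move=> Yy; exists [:: y]; split=> //; last by rewrite big_seq1.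
by move=> z; rewrite inE => /eqP->.
Qed.

(** Letters are multiplied on the left one at a time, and after each one the length is brought back
    to [m]. *)
Lemma word_stable (Y : G -> Prop) m : (forall y, Y y -> Y y^-1%g) ->
  (forall g, word Y m.+1 g -> word Y m g) ->
  forall g, generated Y g -> word Y m g.
Proof.
move=> YV st g Yg.
have [w wY ->] : exists2 w : seq G, forall y, y \in w -> Y y &
    g = (\prod_(y <- w) y)%g.
  elim: Yg => [|y Yy|x y _ [u uY ->] _ [v vY ->]|x _ [u uY ->]].
  - by exists [::]; rewrite ?big_nil.
  - exists [:: y]; last by rewrite big_seq1.
    by move=> z; rewrite inE => /eqP->.
  - exists (u ++ v); last by rewrite big_cat.
    by move=> z; rewrite mem_cat => /orP[/uY|/vY].
  - elim: u uY => [|y u IH] uY; first by exists [::]; rewrite ?big_nil// invg1.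
    have [|v vY e] := IH; first by move=> z zu; apply: uY; rewrite inE zu orbT.
    exists (v ++ [:: y^-1%g]).
      move=> z; rewrite mem_cat inE => /orP[/vY//|/eqP->].
      by apply/YV/uY; rewrite inE eqxx.
    by rewrite big_cons invgM big_cat big_seq1 e.
elim: w wY => [|y w IH] wY; first by exists [::].
rewrite big_cons; apply: st; rewrite -add1n; apply: word_mul.
  by apply/word1/wY; rewrite inE eqxx.
by apply: IH => z zw; apply: wY; rewrite inE zw orbT.
Qed.

(* If [p + 1] disjoint translates of a set [P] with [P * P^-1 <= Y^2] cannot
   exist, then the chain of powers of [Y] must stall within [3 p + 2] steps:
   otherwise pick [g_i] in [Y^(3i+3)] but not in [Y^(3i+2)]. *)
Lemma bounded_generation (P Y : G -> Prop) p :
  (forall x, P x -> Y x) -> (forall y, Y y -> Y y^-1%g) ->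
  (forall gs : seq G, pairwise (fun g h => `[< forall x y, P x -> P y ->
     g * x <> h * y >])%g gs -> (size gs <= p)%N) ->
  forall g, generated Y g -> word Y (3 * p + 2) g.
Proof.
move=> PY YV hp g Yg.
have [i ip st] : exists2 i, (i <= p)%N &
    forall g, word Y (3 * i + 3) g -> word Y (3 * i + 2) g.
  apply: contrapT => ne.
  have /choice[f Hf] : forall i, exists g, (i <= p)%N ->
      word Y (3 * i + 3) g /\ ~ word Y (3 * i + 2) g.
    move=> i; have [ip|_] := leqP i p; last by exists 1%g.
    apply: contrapT => nh; apply: ne; exists i => // h hi.
    by apply: contrapT => hh; apply: nh; exists h.
  suff /hp : pairwise (fun g h => `[< forall x y, P x -> P y ->
      g * x <> h * y >])%g [seq f i | i <- iota 0 p.+1].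
    by rewrite size_map size_iota ltnn.
  rewrite pairwise_map.
  have : pairwise ltn (iota 0 p.+1).
    by rewrite -sorted_pairwise ?iota_ltn_sorted//; apply: ltn_trans.
  apply: (@sub_in_pairwise _ [pred i | (i <= p)%N]); last first.
    by apply/allP => i; rewrite mem_iota add0n ltnS.
  move=> i j ip jp ij; apply/asboolP => x y Px Py e.
  have [[wi _] [_]] := (Hf i ip, Hf j jp); apply.
  have -> : f j = (f i * (x * y^-1))%g by rewrite mulgA e mulgK.
  have wxy := word_mul (word1 (PY _ Px)) (word1 (YV _ (PY _ Py))).
  apply: word_le (word_mul wi wxy).
  by move: (ij : (i < j)%N); lia.
have st' g' : word Y (3 * i + 2).+1 g' -> word Y (3 * i + 2) g'.
  by rewrite -addnS; apply: st.
by apply: word_le (word_stable YV st' Yg); rewrite leq_add2r leq_mul2l.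
Qed.

End Words.

(** * The derived subgroup of a group boundedly generated by elements with few conjugates *)

Section BoundedClasses.
Variable G : groupType.
Implicit Types (C H L N : G -> Prop) (l h : seq G).
Local Open Scope group_scope.

Lemma cent_conj (x g : G) : cent x g <-> x ^ g = x.
Proof.
rewrite /cent /conjg; split=> [->|e]; first by rewrite mulKg.
by rewrite -{2}e mulVKg.
Qed.

Lemma conjg_centl h c d : centl h c ->
  generated (fun x => x \in h) d -> c ^ d = c.
Proof.
move=> ch hd; apply/cent_conj.
by apply: (generated_min (cent_subgroup c)) hd => x xh; apply/cent_sym/ch.
Qed.

Lemma fcc_conj_size (x : G) n (ds : seq G) : fcc n x ->
  uniq [seq x ^ d | d <- ds] -> (size ds <= n)%N.
Proof.
move=> nx; rewrite uniq_pairwise pairwise_map => u.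
(* [x ^ d] depends on the right coset of [d] modulo the centraliser, and inversion passes to left
   cosets. *)
rewrite -(size_map (fun d => d^-1)); apply: nx => //.
rewrite pairwise_map; apply: sub_pairwise u => d e /= /eqP de.
apply/asboolP; rewrite invgK => /cent_conj c; apply: de.
by rewrite -[in RHS]c -conjgM mulgVK.
Qed.

Lemma commgM_conj (x y z : G) : [~ x * y, z] = [~ x, z] ^ y * [~ y, z].
Proof. by rewrite /commg /conjg !invgM !mulgA !mulgK. Qed.

Lemma commgV_conj (x z : G) : [~ x^-1, z] = ([~ x, z]^-1) ^ x^-1.
Proof. by rewrite /commg /conjg !invgM !invgK !mulgA mulgK. Qed.

(** For [N] normal in [L], the preimage in [L] of the centre of [L / N]. *)
Definition central_mod L N : G -> Prop :=
  fun u => L u /\ forall g, L g -> N [~ u, g].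

Lemma central_mod_subgroup L N : is_subgroup L -> is_subgroup N ->
  (forall u g, N u -> L g -> N (u ^ g)) -> is_subgroup (central_mod L N).
Proof.
move=> [L1 LM LV] [N1 NM NV] NJ; split.
- by split=> // g _; rewrite comm1g.
- move=> u v [Lu Nu] [Lv Nv]; split; first exact: LM.
  move=> g Lg; rewrite commgM_conj.
  exact: NM (NJ _ _ (Nu _ Lg) Lv) (Nv _ Lg).
- move=> u [Lu Nu]; split; first exact: LV.
  move=> g Lg; rewrite commgV_conj.
  exact: NJ _ _ (NV _ (Nu _ Lg)) (LV _ Lu).
Qed.

(* A chain of subgroups generated by [C] and more and more elements of [Y]
   at least doubles the number of cosets of [C] at each strict step. *)
Lemma generators_over L C (Y : G -> Prop) B : is_subgroup L ->
  is_subgroup C -> (forall y, Y y -> L y) -> idx L C B ->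
  exists T : seq G, [/\ forall t, t \in T -> Y t, (2 ^ size T <= B)%N &
    forall y, Y y -> generated (fun z => (C z /\ L z) \/ z \in T) y].
Proof.
move=> sL sC YL iC; have [L1 LM LV] := sL.
pose K (T : seq G) := generated (fun z => (C z /\ L z) \/ z \in T).
have KL T : (forall t, t \in T -> Y t) -> forall z, K T z -> L z.
  by move=> TY; apply: generated_min => // z [[]|/TY/YL].
pose Q T q := [/\ forall t, t \in T -> Y t, size T = q &
  exists l, [/\ size l = (2 ^ q)%N, forall z, z \in l -> K T z &
                pairwise (noncong C) l]].
pose P q := `[< exists T, Q T q >].
have QB T q : Q T q -> (2 ^ q <= B)%N.
  move=> [TY _ [l [<- lK pl]]]; apply: iC => // z /lK; exact: KL.
have P0 : exists q, P q.
  exists 0%N; apply/asboolP; exists [::]; split=> //.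
  exists [:: 1]; split=> // z; rewrite inE => /eqP->.
  exact: gen_one.
have PB q : P q -> (q <= B)%N.
  by move=> /asboolP[T /QB]; apply: leq_trans; rewrite ltnW// ltn_expl.
have [q /asboolP[T QT] qmax] := ex_maxnP P0 PB.
have [TY sT [l [sl lK pl]]] := QT.
exists T; split=> //; first by rewrite sT; apply: QB QT.
move=> y Yy; apply: contrapT => nKy.
have : P q.+1.
  apply/asboolP; exists (y :: T); split.
  - by move=> t; rewrite inE => /predU1P[->//|/TY].
  - by rewrite /= sT.
  have KS z : K T z -> K (y :: T) z.
    apply: generated_min; first exact: generated_subgroup.
    by move=> u [uC|uT]; apply: gen_in; [left|right; rewrite inE uT orbT].
  have Ky : K (y :: T) y by apply: gen_in; right; rewrite inE eqxx.
  exists (l ++ [seq y * z | z <- l]); split.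
  - by rewrite size_cat size_map sl expnS mul2n addnn.
  - move=> z; rewrite mem_cat => /orP[/lK/KS//|/mapP[u /lK/KS Ku ->]].
    exact: gen_mul.
  - rewrite pairwise_cat pl pairwise_map /= andbC.
    have -> : pairwise (relpre (fun z => y * z) (noncong C)) l.
      apply: sub_pairwise pl => u v /asboolP h; apply/asboolP => /=.
      by rewrite invgM -mulgA mulKg.
    (* If [u] and [y * v] shared a coset of [C], then [u^-1 * (y * v)] would be in [C] and in [L],
       hence in [K T], and so would [y]. *)
    apply/allrelP => u _ ul /mapP[v vl ->].
    apply/asboolP => Cuv; apply: nKy.
    have Ku := lK _ ul; have Kv := lK _ vl.
    have : K T (u^-1 * (y * v)).
      apply: gen_in; left; split=> //.
      exact: LM (LV _ (KL T TY _ Ku)) (LM _ _ (YL _ Yy) (KL T TY _ Kv)).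
    move=> Kuv; have := gen_mul (gen_mul Ku Kuv) (gen_inv Kv).
    by rewrite mulVKg mulgK.
by move=> /qmax; rewrite ltnn.
Qed.

Definition derived L : G -> Prop :=
  generated (fun z => exists u v, [/\ L u, L v & z = [~ u, v]]).

Section BoundedGeneration.
Variables (Y : G -> Prop) (k r : nat).
Hypothesis k_gt0 : (0 < k)%N.
Hypothesis Yk : forall y, Y y -> fcc k y.
Let L : G -> Prop := generated Y.
Hypothesis Yr : forall g, L g -> word Y r g.
Let n := (k ^ r)%N.
Let sL : is_subgroup L := generated_subgroup Y.

Lemma fcc_bounded_gen g : L g -> fcc n g.
Proof.
move=> /Yr[w [wr wY ->]].
have : fcc (k ^ size w) (\prod_(y <- w) y).
  elim: w wY {wr} => [|y w IH] wY.
    move=> l _; rewrite expn0 big_nil; case: l => [|a [|b l]] //= /andP[].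
    by move=> /andP[/asboolP []]; rewrite /cent mulg1 mul1g.
  rewrite big_cons /= expnS; apply: fccM; first by apply/Yk/wY; rewrite inE eqxx.
  by apply: IH => z zw; apply: wY; rewrite inE zw orbT.
by apply: idx_sub => //; rewrite leq_pexp2l.
Qed.

(* [x] has [2 ^ size h] conjugates under [<h>], with [size h] maximal: adding
   one generator [g] cannot double the orbit of [c * x]. *)
Lemma doubling_orbit : exists x h, [/\ L x, (2 ^ size h <= n)%N,
  forall z, z \in h -> L z &
  forall c g, L c -> centl h c -> L g ->
  exists d e, [/\ L d, L e & c * x ^ d = (c * x ^ e) ^ g]].
Proof.
have [L1 LM LV] := sL.
pose Q x (h : seq G) ds := [/\ L x, forall z, z \in h -> L z,
  forall d, d \in ds -> generated (fun z => z \in h) d,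
  uniq [seq x ^ d | d <- ds] & size ds = (2 ^ size h)%N].
pose P q := `[< exists x h ds, Q x h ds /\ size h = q >].
have QL x h ds : Q x h ds -> forall d, d \in ds -> L d.
  by move=> [_ hL dsh _ _] d /dsh; apply: generated_min.
have QB x h ds : Q x h ds -> (2 ^ size h <= n)%N.
  by move=> [Lx _ _ u <-]; apply: fcc_conj_size u; apply: fcc_bounded_gen.
have P0 : exists q, P q.
  exists 0%N; apply/asboolP; exists 1, [::], [:: 1]; split=> //; split=> //.
  by move=> d; rewrite inE => /eqP->; apply: gen_one.
have PB q : P q -> (q <= n)%N.
  move=> /asboolP[x [h [ds [/QB hn <-]]]]; apply: leq_trans hn.
  by rewrite ltnW// ltn_expl.
have [q /asboolP[x [h [ds [Qx hq]]]] qmax] := ex_maxnP P0 PB.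
have [Lx hL dsh uds sds] := Qx.
exists x, h; split=> //; first exact: QB Qx.
move=> c g Lc ch Lg; apply: contrapT => ne.
have : P q.+1; last by move=> /qmax; rewrite ltnn.
(* Since [c] commutes with [h], the orbit of [c * x] contains the translate by [c] of the old one;
   the assumption [ne] makes its conjugate by [g] disjoint from it. *)
apply/asboolP; exists (c * x), (g :: h), (ds ++ [seq d * g | d <- ds]).
split; last by rewrite /= hq.
have cd d : d \in ds -> (c * x) ^ d = c * x ^ d.
  by move=> /dsh hd; rewrite conjMg (conjg_centl ch hd).
have hS d : generated (fun z => z \in h) d ->
    generated (fun z => z \in g :: h) d.
  apply: generated_min; first exact: generated_subgroup.
  by move=> u uh; apply: gen_in; rewrite inE uh orbT.
split.
- exact: LM.
- by move=> z; rewrite inE => /predU1P[->//|/hL].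
- move=> d; rewrite mem_cat => /orP[/dsh/hS//|/mapP[e /dsh/hS he ->]].
  by apply: gen_mul => //; apply: gen_in; rewrite inE eqxx.
- have -> : [seq (c * x) ^ d | d <- ds ++ [seq d * g | d <- ds]] =
      [seq c * z | z <- [seq x ^ d | d <- ds]] ++
      [seq (c * z) ^ g | z <- [seq x ^ d | d <- ds]].
    rewrite map_cat -!map_comp; congr (_ ++ _); apply/eq_in_map => d dds /=.
      by rewrite cd.
    by rewrite conjgM cd.
  rewrite cat_uniq map_inj_uniq ?uds /=; last exact: mulgI.
  rewrite map_inj_uniq ?uds ?andbT; last first.
    by move=> u v /conjg_inj/mulgI.
  apply/hasPn => _ /mapP[_ /mapP[e eds ->] ->].
  apply/negP => /mapP[_ /mapP[d dds ->] de]; apply: ne; exists d, e.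
  by split => //; apply: QL Qx _ _.
- by rewrite size_cat size_map sds /= expnS mul2n addnn.
Qed.

(** Here [p] counts the list [h] of [doubling_orbit], and [q] the elements [T] that generate [Y]
    over the centraliser of [h]. Modulo a finite subgroup [N] built from [T] and the letters of [x],
    all of [L] is central. *)
Lemma derived_bounded : exists (p q : nat) (t : seq G),
  [/\ (2 ^ p <= n)%N, (2 ^ q <= n ^ p)%N,
      (size t <= ((k * n) * (k * n)) ^ ((r + q) * (k * k)))%N &
      forall z, derived L z -> z \in t].
Proof.
have [L1 LM LV] := sL.
have [x [h [Lx hn hL orb]]] := doubling_orbit.
have YL y : Y y -> L y by apply: gen_in.
have iC : idx L (centl h) (n ^ size h)%N.
  apply: idx_centl => z /hL /fcc_bounded_gen; exact: idx_sub.
have [T [TY Tn TC]] := generators_over sL (centl_subgroup h) YL iC.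
have [w [wr wY xw]] := Yr Lx.
have /choice[cl Hcl] : forall y, exists cl : seq G, Y y ->
    (size cl <= k)%N /\ forall z, z \in cl <-> exists2 g, L g & z = y ^ g.
  move=> y; have [Yy|] := pselect (Y y); last by exists [::].
  have iy : idx L (cent y) k by apply: idx_sub (Yk Yy).
  have [a [aL _ cov _ ak]] := idx_reps (cent_subgroup y) iy.
  exists [seq y ^ b^-1 | b <- a] => _; rewrite size_map; split=> // z.
  split=> [/mapP[b /aL/LV Lb ->]|[g Lg ->]]; first by exists b^-1.
  have [b ba /cent_conj e] := cov _ (LV _ Lg).
  by apply/mapP; exists b => //; rewrite -[in LHS]e -conjgM mulgVK.
pose Y0 := w ++ T.
have Y0Y y : y \in Y0 -> Y y by rewrite mem_cat => /orP[/wY|/TY].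
(* Quotients of two [L]-conjugates of the same [y]: they include the commutators of [y] with [L],
   and conjugation by [L] permutes them. *)
pose S := flatten [seq [seq a^-1 * b | a <- cl y, b <- cl y] | y <- Y0].
have SP z : z \in S <-> exists y u v,
    [/\ y \in Y0, L u, L v & z = (y ^ u)^-1 * y ^ v].
  split.
    move=> /flattenP[_ /mapP[y yY ->]] /allpairsP[[a b] /= [acl bcl ->]].
    have [_ Hy] := Hcl y (Y0Y _ yY).
    have [u Lu ->] := (Hy a).1 acl; have [v Lv ->] := (Hy b).1 bcl.
    by exists y, u, v.
  move=> [y [u [v [yY Lu Lv ->]]]]; have [_ Hy] := Hcl y (Y0Y _ yY).
  apply/flattenP; exists [seq a^-1 * b | a <- cl y, b <- cl y].
    by apply: map_f.
  by apply/allpairsP; exists (y ^ u, y ^ v); split=> //=; apply/Hy;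
    [exists u|exists v].
have sizeS : (size S <= (r + size T) * (k * k))%N.
  apply: (@leq_trans (size Y0 * (k * k))); last first.
    by rewrite leq_mul2r size_cat leq_add2r wr orbT.
  rewrite /S; elim: (Y0) Y0Y => //= y s IH sY.
  rewrite size_cat size_allpairs mulSn leq_add//.
    by have [ck _] := Hcl y (sY y (mem_head _ _)); rewrite leq_mul.
  by apply: IH => z zs; apply: sY; rewrite inE zs orbT.
have SL z : z \in S -> L z.
  move=> /SP[y [u [v [/Y0Y/YL Ly Lu Lv ->]]]].
  have LJ d : L d -> L (y ^ d) by move=> Ld; exact: LM (LV _ Ld) (LM _ _ Ly Ld).
  exact: LM (LV _ (LJ _ Lu)) (LJ _ Lv).
have SJ z g : z \in S -> L g -> z ^ g \in S.
  move=> /SP[y [u [v [yY Lu Lv ->]]]] Lg; apply/SP.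
  exists y, (u * g), (v * g); split; [by []|exact: LM|exact: LM|].
  by rewrite conjMg conjVg !conjgM.
have Sorder z : z \in S ->
    exists2 e, (0 < e <= (k * n) * (k * n))%N & z ^+ e = 1.
  move=> /SP[y [u [v [/Y0Y Yy Lu Lv ->]]]].
  pose a := y ^ u; pose g := u^-1 * v.
  have -> : a^-1 * y ^ v = [~ a, g] by rewrite commgEl -conjgM mulVKg.
  (* The transfer is applied in the subgroup generated by [a] and [g] alone, where the elements
     commuting with both are central and have index at most [k * n]. *)
  pose M := generated (fun z => z = a \/ z = g).
  have sM : is_subgroup M := generated_subgroup _.
  have sc := subgroupI (cent_subgroup a) (cent_subgroup g).
  have iZ : idx (@full G) (fun z => cent a z /\ cent g z) (k * n)%N.
    apply: idxI; try exact: cent_subgroup.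
      exact/fccJ/Yk.
    by apply: fcc_bounded_gen; apply: (LM); first exact: LV.
  apply: (@commg_order G M (fun z => M z /\ (cent a z /\ cent g z))).
  - exact: sM.
  - exact: subgroupI.
  - by move=> c [].
  - move=> c b [_ [ac gc]] Mb; apply: (generated_min (cent_subgroup c)) Mb.
    by move=> _ [->|->]; apply: cent_sym.
  - move=> l lM pl; apply: iZ => //.
    apply: (@sub_in_pairwise _ [pred c | `[< M c >]]) pl; last first.
      by apply/allP => c /lM Mc; apply/asboolP.
    move=> b d /asboolP Mb /asboolP Md /asboolP h0; apply/asboolP => h1.
    have [_ MM MV] := sM.
    by apply: h0; split=> //; exact: MM (MV _ Mb) Md.
  - by apply: gen_in; left.
  - by apply: gen_in; right.
have [|t [st ht]] := dietzmann _ Sorder.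
  by move=> a b aS bS; apply: SJ => //; apply: SL.
pose N := generated (fun z => z \in S).
have sN : is_subgroup N := generated_subgroup _.
have NJ u g : N u -> L g -> N (u ^ g).
  move=> Nu Lg; apply: (generated_min (H := fun u => N (u ^ g))) Nu.
    split.
    - by rewrite conj1g; apply: gen_one.
    - by move=> a b Na Nb; rewrite conjMg; apply: gen_mul.
    - by move=> a Na; rewrite conjVg; apply: gen_inv.
  by move=> a aS; apply: gen_in; apply: SJ.
have sZ := central_mod_subgroup sL sN NJ.
have Y0Z y : y \in Y0 -> central_mod L N y.
  move=> yY; split; first exact/YL/Y0Y.
  move=> g Lg; apply: gen_in; apply/SP; exists y, 1, g.
  by split=> //; rewrite conjg1 commgEl.
have [_ Nx] : central_mod L N x.
  rewrite xw; apply: subgroup_prod => // y yw.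
  by apply: Y0Z; rewrite mem_cat yw.
have CZ c : centl h c /\ L c -> central_mod L N c.
  move=> [ch Lc]; split=> // g Lg.
  have [d [e [Ld Le de]]] := orb c g Lc ch Lg.
  (* The orbit relation [de] makes this commutator a quotient of two conjugates of [x], and [x] is
     already central modulo [N]. *)
  have -> : [~ c, g] = ([~ x, d] * [~ x, e * g]^-1) ^ x^-1.
    have -> : [~ c, g] = x ^ d * (x ^ (e * g))^-1.
      by rewrite commgEl conjgM; apply: (mulgI c); apply: (mulIg ((x ^ e) ^ g));
        rewrite mulVKg -conjMg -de -!mulgA mulVg mulg1.
    by rewrite !commgEl /conjg !invgM !invgK !mulgA !mulgK mulgV mul1g.
  apply: NJ; last exact: LV.
  exact: gen_mul (Nx _ Ld) (gen_inv (Nx _ (LM _ _ Le Lg))).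
have LZ g : L g -> central_mod L N g.
  apply: generated_min => // y /TC; apply: generated_min => // z [/CZ//|zT].
  by apply: Y0Z; rewrite mem_cat zT orbT.
exists (size h), (size T), t; split => //.
  apply: leq_trans st _; apply: leq_pexp2l => //.
  by rewrite !muln_gt0 k_gt0 expn_gt0 k_gt0.
move=> z zR; apply: ht; apply: generated_min zR => // _ [u [v [Lu Lv ->]]].
by have [_] := LZ _ Lu; apply.
Qed.
End BoundedGeneration.
End BoundedClasses.

(** * Averages along the random walk *)

Section Walk.
Variables (R : realType) (G : groupType) (mu : G -> R) (s : seq G).
Local Open Scope ring_scope.
Hypothesis s_supp : forall x, (x \in s) = (mu x != 0).
Hypothesis mu_ge0 : forall x, 0 <= mu x.
Hypothesis mu_sum : \sum_(x <- s) mu x = 1.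
Hypothesis mu_sym : forall x, mu x = mu (x^-1)%g.
Hypothesis s_gen : forall g, generated (fun x => x \in s) g.
Hypothesis mu1_gt0 : 0 < mu 1%g.

Definition walk_mean n (phi : G -> R) : R :=
  \sum_(t <- walk_supp s n) conv_pow mu s n t * phi t.

Local Notation E := walk_mean.

Lemma sum_sub_uniq (T : eqType) (l1 l2 : seq T) (f : T -> R) :
  uniq l1 -> uniq l2 -> {subset l1 <= l2} ->
  (forall x, x \in l2 -> x \notin l1 -> f x = 0) ->
  \sum_(x <- l1) f x = \sum_(x <- l2) f x.
Proof.
move=> u1 u2 s12 f0; rewrite [RHS](bigID (mem l1)) /=.
rewrite [X in _ + X]big_seq_cond [X in _ + X]big1 ?addr0; last first.
  by move=> x /andP[]; apply: f0.
rewrite -[RHS]big_filter; apply: perm_big; apply: uniq_perm => //.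
  exact: filter_uniq.
by move=> x; rewrite mem_filter; case: (boolP (x \in l1)) => // /s12 ->.
Qed.

Lemma conv_pow_supp n x : conv_pow mu s n x != 0 -> x \in walk_supp s n.
Proof.
elim: n x => [|n IH] x /=.
  by rewrite inE; case: (x == 1%g) => //; rewrite eqxx.
move=> h; rewrite mem_undup.
have [y ys hy] : exists2 y, y \in s & conv_pow mu s n (y^-1 * x)%g != 0.
  apply: contrapT => ne; move/negP: h; apply; rewrite big_seq big1// => y ys.
  suff -> : conv_pow mu s n (y^-1 * x)%g = 0 by rewrite mulr0.
  by apply/eqP/negPn/negP => h; apply: ne; exists y.
apply/allpairsP; exists (y, (y^-1 * x)%g); split=> //=; first exact: IH.
by rewrite mulVKg.
Qed.

Lemma walk_mean0 phi : E 0 phi = phi 1%g.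
Proof. by rewrite /E big_seq1 /= eqxx mul1r. Qed.

(** Conditioning on the first step; the support lists on the two sides differ only at points of
    weight zero. *)
Lemma walk_meanS n phi :
  E n.+1 phi = \sum_(y <- s) mu y * E n (fun t => phi (y * t)%g).
Proof.
rewrite /E; under eq_bigr do rewrite /= mulr_suml.
rewrite exchange_big /= big_seq [RHS]big_seq; apply: eq_bigr => y ys.
under eq_bigr do rewrite -mulrA; rewrite -mulr_sumr; congr (_ * _).
pose f x := conv_pow mu s n (y^-1 * x)%g * phi x.
rewrite -[LHS]/(\sum_(x <- undup _) f x).
have -> : \sum_(t <- walk_supp s n) conv_pow mu s n t * phi (y * t)%g =
    \sum_(x <- [seq (y * t)%g | t <- walk_supp s n]) f x.
  by rewrite big_map; apply: eq_bigr => t _; rewrite /f mulKg.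
apply/esym/sum_sub_uniq.
- rewrite map_inj_uniq; last exact: mulgI.
  by case: n {f} => //= n; apply: undup_uniq.
- exact: undup_uniq.
- move=> _ /mapP[t tn ->]; rewrite mem_undup.
  by apply/allpairsP; exists (y, t).
- move=> x _ /mapP h; rewrite /f; apply/eqP; rewrite mulf_eq0.
  apply/orP; left; apply/negPn/negP => /conv_pow_supp hx; apply: h.
  by exists (y^-1 * x)%g => //; rewrite mulVKg.
Qed.

Lemma walk_mean_ext n phi psi : (forall t, phi t = psi t) -> E n phi = E n psi.
Proof. by move=> e; apply: eq_bigr => t _; rewrite e. Qed.

Lemma walk_mean_le n phi psi :
  (forall t, phi t <= psi t) -> E n phi <= E n psi.
Proof.
elim: n phi psi => [|n IH] phi psi h; first by rewrite !walk_mean0.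
rewrite !walk_meanS; apply: ler_sum => y _; apply: ler_wpM2l => //.
exact: IH.
Qed.

Lemma walk_mean_cst n (a : R) : E n (fun=> a) = a.
Proof.
elim: n => [|n IH]; first by rewrite walk_mean0.
rewrite walk_meanS; under eq_bigr do rewrite IH.
by rewrite -mulr_suml mu_sum mul1r.
Qed.

Lemma walk_meanD n phi psi : E n (fun t => phi t + psi t) = E n phi + E n psi.
Proof. by rewrite /E -big_split /=; apply: eq_bigr => t _; rewrite mulrDr. Qed.

Lemma walk_meanZ n (a : R) phi : E n (fun t => a * phi t) = a * E n phi.
Proof. by rewrite /E mulr_sumr; apply: eq_bigr => t _; rewrite mulrCA. Qed.

Lemma walk_meanB n phi psi : E n (fun t => phi t - psi t) = E n phi - E n psi.
Proof.
rewrite walk_meanD; congr (_ + _); rewrite -mulN1r -walk_meanZ.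
by apply: walk_mean_ext => t; rewrite mulN1r.
Qed.

Lemma walk_mean_sum n (I : Type) (l : seq I) (F : I -> G -> R) :
  E n (fun t => \sum_(i <- l) F i t) = \sum_(i <- l) E n (F i).
Proof.
rewrite /E exchange_big /=; apply: eq_bigr => t _.
by rewrite mulr_sumr.
Qed.

Lemma walk_mean_exchange n (F : G -> G -> R) :
  E n (fun t => E n (fun u => F t u)) = E n (fun u => E n (fun t => F t u)).
Proof.
rewrite {2 4}/E walk_mean_sum /E; apply: eq_bigr => u _.
by rewrite mulr_sumr; apply: eq_bigr => t _; rewrite mulrCA.
Qed.

Definition ind (P : Prop) : R := (`[< P >])%:R.

Lemma indT (P : Prop) : P -> ind P = 1.
Proof. by rewrite /ind => /asboolT ->. Qed.

Lemma indF (P : Prop) : ~ P -> ind P = 0.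
Proof. by rewrite /ind => /asboolF ->. Qed.

Lemma ind_eq (P Q : Prop) : (P <-> Q) -> ind P = ind Q.
Proof. by move=> PQ; rewrite /ind (asbool_equiv_eq PQ). Qed.

Lemma ind_ge0 P : 0 <= ind P. Proof. exact: ler0n. Qed.

Lemma ind_le1 P : ind P <= 1. Proof. by rewrite /ind lern1 leq_b1. Qed.

Lemma ind_le (P Q : Prop) : (P -> Q) -> ind P <= ind Q.
Proof.
by move=> PQ; rewrite /ind ler_nat; case: asboolP => // /PQ/asboolT ->.
Qed.

Lemma dc_walkE n :
  dc_walk mu s n = E n (fun t => E n (fun u => ind (cent t u))).
Proof.
rewrite /dc_walk /dc_on /E; apply: eq_bigr => t _.
rewrite mulr_sumr; apply: eq_bigr => u _; rewrite /ind /cent.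
by case: eqP => [e|ne]; [rewrite asboolT// mulr1|rewrite asboolF// !mulr0].
Qed.

(** * Coset probabilities and their squared norms *)

Section Cosets.
Variable H : G -> Prop.
Hypothesis sH : is_subgroup H.

Local Notation K := (fun x y : G => ind (H (x^-1 * y)%g)).

Definition coset_prob n x : R := E n (K x).

Lemma coset_indM a x y : K (a * x)%g (a * y)%g = K x y.
Proof. by rewrite /= invgM -mulgA mulKg. Qed.

Lemma coset_indC x y : K x y = K y x.
Proof.
have [_ _ HV] := sH; apply: ind_eq; split=> /HV; by rewrite invgM invgK.
Qed.

Lemma coset_probS n x :
  coset_prob n.+1 x = \sum_(y <- s) mu y * coset_prob n (y^-1 * x)%g.
Proof.
rewrite /coset_prob walk_meanS; apply: eq_bigr => y _; congr (_ * _).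
by apply: walk_mean_ext => t; rewrite invgM invgK mulgA.
Qed.

(** Each new coset probability is an average of old ones, so a uniform upper bound persists. *)
Lemma coset_prob_le_mono n m b : (n <= m)%N ->
  (forall x, coset_prob n x <= b) -> forall x, coset_prob m x <= b.
Proof.
move=> nm hb; rewrite -(subnKC nm); elim: (m - n)%N => [|d IH] x.
  by rewrite addn0.
rewrite addnS coset_probS -[b]mul1r -mu_sum mulr_suml.
by apply: ler_sum => y _; apply: ler_wpM2l.
Qed.

(** Points in different cosets do not interact, so the coset of [x] contributes the square of its
    mass and the other points form the same kind of sum. *)
Lemma coset_gram_split (l : seq (R * G)) x :
  \sum_(p <- l) \sum_(q <- l) p.1 * q.1 * K p.2 q.2 =
  (\sum_(p <- l) p.1 * K x p.2) ^+ 2 +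
  \sum_(p <- [seq p <- l | `[< ~ H (x^-1 * p.2)%g >]])
   \sum_(q <- [seq p <- l | `[< ~ H (x^-1 * p.2)%g >]]) p.1 * q.1 * K p.2 q.2.
Proof.
rewrite expr2 mulr_suml big_filter [X in _ + X]big_mkcond -big_split /=.
apply: eq_bigr => p _; rewrite mulr_sumr big_filter.
have trans := noncong_trans sH; have [_ HM HV] := sH.
case: asboolP => /= [np|/contrapT hp].
  rewrite [X in _ + X]big_mkcond -big_split /=; apply: eq_bigr => q _.
  rewrite [K x p.2]indF// mulr0 mul0r add0r.
  case: asboolP => // /contrapT hq; rewrite indF ?mulr0// => hpq.
  apply: np; have := HM _ _ hq (HV _ hpq).
  by rewrite invgM invgK -!mulgA mulVKg.
rewrite addr0; apply: eq_bigr => q _; rewrite [K x p.2]indT// mulr1.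
rewrite mulrA; congr (_ * _); apply: ind_eq; split => h.
  by have := HM _ _ hp h; rewrite -mulgA mulVKg.
exact: trans hp h.
Qed.

Lemma coset_gram_ge0 (l : seq (R * G)) :
  0 <= \sum_(p <- l) \sum_(q <- l) p.1 * q.1 * K p.2 q.2.
Proof.
have [m] := ubnP (size l); elim: m l => // m IH [|p l] hs; first by rewrite big_nil.
rewrite (coset_gram_split _ p.2) addr_ge0 ?sqr_ge0//; apply: IH.
have [H1 _ _] := sH.
rewrite /= asboolF ?mulVg; last by move/(_ H1).
rewrite size_filter; apply: leq_ltn_trans (count_size _ _) _.
by move: hs; rewrite /= ltnS.
Qed.

Lemma coset_gram_point (l : seq (R * G)) x :
  (\sum_(p <- l) p.1 * K x p.2) ^+ 2 <=
  \sum_(p <- l) \sum_(q <- l) p.1 * q.1 * K p.2 q.2.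
Proof. by rewrite (coset_gram_split l x) lerDl coset_gram_ge0. Qed.

(** The inner product on [G/H] of the translates by [y] and [z] of the [n]-step coset distribution;
    [corr n 1 1] is its squared norm. *)
Definition corr n y z : R := E n (fun t => E n (fun u => K (y * t)%g (z * u)%g)).

Lemma corr_diag n y : corr n y y = corr n 1 1.
Proof.
apply: walk_mean_ext => t; apply: walk_mean_ext => u.
by rewrite coset_indM !mul1g.
Qed.

Lemma corrC n y z : corr n y z = corr n z y.
Proof.
rewrite /corr walk_mean_exchange; apply: walk_mean_ext => t.
by apply: walk_mean_ext => u; rewrite coset_indC.
Qed.

(** The right side is the squared norm of the difference of the two translates, which bounds the
    square of each value. *)
Lemma corr_step n y z x :
  (coset_prob n (y^-1 * x)%g - coset_prob n (z^-1 * x)%g) ^+ 2 <=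
  2 * (corr n 1 1 - corr n y z).
Proof.
pose l := [seq (conv_pow mu s n t, (y * t)%g) | t <- walk_supp s n] ++
          [seq (- conv_pow mu s n t, (z * t)%g) | t <- walk_supp s n].
have lE (phi : G -> R) : \sum_(p <- l) p.1 * phi p.2 =
    E n (fun t => phi (y * t)%g) - E n (fun t => phi (z * t)%g).
  rewrite big_cat !big_map /= /E; congr (_ + _).
  by rewrite -sumrN; apply: eq_bigr => t _; rewrite mulNr.
have := coset_gram_point l x; rewrite (lE (K x)).
have shift a : E n (fun t => K x (a * t)%g) = coset_prob n (a^-1 * x)%g.
  by apply: walk_mean_ext => t; rewrite invgM invgK mulgA.
rewrite !shift => /le_trans; apply.
under eq_bigr => p _.
  under eq_bigr => q _ do rewrite -mulrA.
  rewrite -mulr_sumr (lE (K p.2)); over.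
rewrite (lE (fun g => E n (fun t => K g (y * t)%g) - E n (fun t => K g (z * t)%g))).
rewrite !walk_meanB -!/(corr n _ _).
rewrite (corr_diag n y) (corr_diag n z) (corrC n z y).
by rewrite le_eqVlt; apply/orP; left; apply/eqP; ring.
Qed.

Lemma corrS n : corr n.+1 1 1 =
  \sum_(y <- s) mu y * \sum_(z <- s) mu z * corr n y z.
Proof.
rewrite /corr walk_meanS; apply: eq_bigr => y _; congr (_ * _).
under [LHS]walk_mean_ext => t do rewrite walk_meanS.
rewrite walk_mean_sum; apply: eq_bigr => z _; rewrite walk_meanZ.
congr (_ * _); apply: walk_mean_ext => t; apply: walk_mean_ext => u.
by rewrite !mul1g.
Qed.

(** The decrement averages the nonnegative numbers [corr n 1 1 - corr n u z] over two independent
    steps; only the pair of steps [1] and [y] is kept. *)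
Lemma corr_decrease n x y : y \in s ->
  mu 1%g * mu y * (coset_prob n x - coset_prob n (y^-1 * x)%g) ^+ 2 <=
  2 * (corr n 1 1 - corr n.+1 1 1).
Proof.
move=> ys; have s1 : 1%g \in s by rewrite s_supp gt_eqF.
have dE : corr n 1 1 - corr n.+1 1 1 =
    \sum_(u <- s) mu u * \sum_(z <- s) mu z * (corr n 1 1 - corr n u z).
  rewrite corrS -[in LHS](mul1r (corr n 1 1)) -[in LHS]mu_sum mulr_suml.
  rewrite -sumrB; apply: eq_bigr => u _; rewrite -mulrBr; congr (_ * _).
  rewrite -[in LHS](mul1r (corr n 1 1)) -[in LHS]mu_sum mulr_suml.
  by rewrite -sumrB; apply: eq_bigr => z _; rewrite -mulrBr.
have c0 u z : 0 <= corr n 1 1 - corr n u z.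
  have := corr_step n u z 1%g; move=> /(le_trans (sqr_ge0 _)).
  by rewrite pmulr_rge0.
have in0 u : 0 <= mu u * \sum_(z <- s) mu z * (corr n 1 1 - corr n u z).
  by rewrite mulr_ge0// sumr_ge0// => z _; rewrite mulr_ge0.
have : mu 1%g * mu y * (corr n 1 1 - corr n 1 y) <=
    corr n 1 1 - corr n.+1 1 1.
  rewrite dE (big_rem _ s1) /=; apply: le_trans (ler_wpDr _ (lexx _)); last first.
    exact: sumr_ge0.
  rewrite -mulrA; apply: ler_wpM2l => //.
  rewrite (big_rem _ ys) /=; apply: ler_wpDr => //.
  by apply: sumr_ge0 => z _; rewrite mulr_ge0.
have := corr_step n 1%g y x; rewrite invg1 mul1g.
move=> /(ler_wpM2l (mulr_ge0 (mu_ge0 1%g) (mu_ge0 y))) h1 h2.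
by apply: le_trans h1 _; rewrite mulrCA ler_pM2l.
Qed.

Lemma coset_prob_sum_le1 n (l : seq G) : pairwise (noncong H) l ->
  \sum_(y <- l) coset_prob n y <= 1.
Proof.
move=> pl; rewrite /coset_prob -walk_mean_sum -[leRHS](walk_mean_cst n).
apply: walk_mean_le => t; elim: l pl => [|y l IH] /=; first by rewrite big_nil.
move=> /andP[/allP yl /IH{}IH]; rewrite big_cons.
case: (pselect (H (y^-1 * t)%g)) => [hy|ny]; last by rewrite indF ?add0r.
rewrite indT// big_seq big1 ?addr0// => z zl; rewrite indF// => hz.
have /asboolP := yl z zl; apply.
have sV u v : H (u^-1 * v)%g -> H (v^-1 * u)%g.
  by have [_ _ HV] := sH => /HV; rewrite invgM invgK.
exact: noncong_trans sH (sV _ _ hy) (sV _ _ hz).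
Qed.

(** The Schreier graph is connected: a union of at most [m] cosets stable under the generators would
    be all of [G]. So some generator reaches a new coset, where [phi] has lost at most one more
    [eta]. *)
Lemma index_chain (phi : G -> R) (eta : R) m x : 0 <= eta -> ~ idx (@full G) H m ->
  (forall y z, y \in s -> phi z - eta <= phi (y * z)%g) ->
  exists l, [/\ size l = m.+1, pairwise (noncong H) l &
    forall z, z \in l -> phi x - m%:R * eta <= phi z].
Proof.
move=> eta0 nidx step; have [H1 HM HV] := sH.
suff P i : (i <= m)%N -> exists l, [/\ size l = i.+1, pairwise (noncong H) l &
    forall z, z \in l -> phi x - i%:R * eta <= phi z] by exact: P.
elim: i => [_|i IH im].
  exists [:: x]; split=> // z; rewrite inE => /eqP->.
  by rewrite mul0r subr0.
have [l [sl pl lphi]] := IH (ltnW im).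
have [y [v [ys vl yv]]] : exists y v, [/\ y \in s, v \in l &
    forall u, u \in l -> ~ H ((y * v)^-1 * u)%g].
  apply: contrapT => ne; apply: nidx.
  pose U u := exists2 v, v \in l & H (v^-1 * u)%g.
  have sU y u : y \in s -> U u -> U (y * u)%g.
    move=> ys [v vl hv]; apply: contrapT => nU; apply: ne.
    exists y, v; split=> // w wl hw; apply: nU; exists w => //.
    have := HM _ _ (HV _ hw) hv; rewrite invgM invgK !mulgA.
    by rewrite mulgK.
  have gU g : (forall u, U u -> U (g * u)%g) /\ (forall u, U u -> U (g^-1 * u)%g).
    elim: (s_gen g) => [|y ys|a b _ [a1 a2] _ [b1 b2]|a _ [a1 a2]].
    - by split=> u; rewrite ?invg1 mul1g.
    - split=> u; apply: sU => //.
      by rewrite s_supp -mu_sym -s_supp.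
    - split=> u; first by rewrite -mulgA => /b1/a1.
      by rewrite invgM -mulgA => /a2/b2.
    - by split; rewrite ?invgK.
  apply: (@cover_idx _ _ _ l) => //; first by rewrite sl.
  have [v vl] : exists v, v \in l.
    by case: (l) sl => // v l' _; exists v; rewrite inE eqxx.
  have Uv : U v by exists v => //; rewrite mulVg.
  move=> g _; have := (gU (g * v^-1)%g).1 _ Uv.
  by rewrite mulgVK.
exists ((y * v)%g :: l); split; first by rewrite /= sl.
  by rewrite /= pl andbT; apply/allP => u /yv h; apply/asboolP.
have e0 : 0 <= i%:R * eta :> R by rewrite mulr_ge0.
move=> z; rewrite inE => /predU1P[->|/lphi]; rewrite -natr1.
  by have := step y v ys; have := lphi v vl; lra.
by lra.
Qed.

End Cosets.

Lemma mu_lower : exists2 c : R, 0 < c & forall y, y \in s -> c <= mu y.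
Proof.
have : forall y, y \in s -> 0 < mu y.
  by move=> y; rewrite s_supp lt_neqAle mu_ge0 andbT eq_sym.
elim: s => [|x l IH] h; first by exists 1.
have [|c c0 cl] := IH; first by move=> y yl; apply: h; rewrite inE yl orbT.
exists (Num.min c (mu x)).
  by rewrite lt_min c0 h// inE eqxx.
move=> y; rewrite inE => /predU1P[->|/cl cy]; first by rewrite ge_min lexx orbT.
by rewrite ge_min cy.
Qed.

(* The decreasing sequence [corr n 1 1] lies in [0, 1], so one of any [N]
   consecutive decrements is at most [1 / N]; at such a time the coset
   probabilities are almost invariant under the generators. *)
Lemma coset_prob_almost_const (eta : R) : 0 < eta -> exists N, forall H,
  is_subgroup H -> exists2 j, (j < N)%N & forall y z, y \in s ->
    coset_prob H j z - eta <= coset_prob H j (y * z)%g.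
Proof.
move=> eta0; have [c c0 hc] := mu_lower.
(* With this [d], a decrement of at most [d] in [corr_decrease] forces a squared difference of at
   most [eta ^+ 2]. *)
pose d := mu 1%g * c * eta ^+ 2 / 2.
have d0 : 0 < d by rewrite /d divr_gt0// mulr_gt0 ?exprn_gt0// mulr_gt0.
pose N := (Num.truncn d^-1).+1.
have Nd : 1 < N%:R * d.
  by rewrite -ltr_pdivrMr// div1r; apply: truncnS_gt.
exists N => H sH.
pose a n := corr H n 1 1.
have [j jN aj] : exists2 j, (j < N)%N & a j - a j.+1 <= d.
  apply: contrapT => ne.
  have lt j : (j < N)%N -> d < a j - a j.+1.
    by move=> jN; rewrite ltNge; apply/negP => h; apply: ne; exists j.
  have tele M : (M <= N)%N -> M%:R * d <= a 0%N - a M.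
    elim: M => [|M IH] MN; first by rewrite mul0r subrr.
    rewrite -natr1 mulrDl mul1r; have := IH (ltnW MN); have := lt M MN; lra.
  have a0 : a 0%N = 1.
    by rewrite /a /corr !walk_mean0 mulVg indT//; case: sH.
  have aN : 0 <= a N.
    rewrite -(walk_mean_cst N 0); apply: walk_mean_le => t.
    by rewrite -(walk_mean_cst N 0); apply: walk_mean_le => u; apply: ind_ge0.
  by have := tele N (leqnn N); rewrite a0; lra.
exists j => // y z ys.
have ys' : (y^-1)%g \in s by rewrite s_supp -mu_sym -s_supp.
have h := corr_decrease sH j z ys'; rewrite invgK in h.
set u := coset_prob H j z in h *; set v := coset_prob H j _ in h *.
have : (u - v) ^+ 2 <= eta ^+ 2.
  rewrite -(ler_pM2l (mulr_gt0 mu1_gt0 c0)).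
  have h1 : 2 * (a j - a j.+1) <= mu 1%g * c * eta ^+ 2.
    by rewrite mulrC -ler_pdivlMr.
  apply: le_trans h1; apply: le_trans h; apply: ler_wpM2r; first exact: sqr_ge0.
  by rewrite ler_pM2l//; apply: hc.
move=> h1; have : u - v <= eta; last by lra.
have [uv|uv] := leP (u - v) 0; first by apply: le_trans uv _; apply: ltW.
by move: h1; rewrite ler_pXn2r// nnegrE; apply: ltW.
Qed.

(** At an almost invariant time, a coset of probability [a] yields [m + 1] cosets of probability at
    least [a - m * eta], with total at most 1. The bound then persists, and [N] is uniform in
    [H]. *)
Lemma coset_prob_index m (delta : R) : 0 < delta -> exists N, forall n, (N <= n)%N ->
  forall H, is_subgroup H -> ~ idx (@full G) H m -> forall x,
    coset_prob H n x <= m.+1%:R^-1 + delta.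
Proof.
move=> d0; pose eta := delta / m.+1%:R.
have m0 : 0 < m.+1%:R :> R by rewrite ltr0n.
have eta0 : 0 < eta by rewrite divr_gt0.
have [N hN] := coset_prob_almost_const eta0.
exists N => n Nn H sH nidx; have [j jN hj] := hN H sH.
apply: (coset_prob_le_mono (leq_trans (ltnW jN) Nn)) => x.
have [l [sl pl lphi]] := index_chain sH x (ltW eta0) nidx hj.
have := coset_prob_sum_le1 sH j pl.
set a := coset_prob H j x in lphi *.
have : (a - m%:R * eta) *+ m.+1 <= \sum_(y <- l) coset_prob H j y.
  rewrite -sl -iter_addr_0 -[size l]count_predT -big_const_seq.
  by rewrite big_seq [leRHS]big_seq; apply: ler_sum => y /lphi.
rewrite -[(_ - _) *+ _]mulr_natr => h1 h2; have := le_trans h1 h2.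
rewrite -ler_pdivlMr// div1r lerBlDr => /le_trans; apply; rewrite lerD2l.
rewrite /eta mulrC mulrAC ler_pdivrMr// ler_pM2l// ler_nat.
exact: leqnSn.
Qed.

(** * Degree of commutativity, the centre, and conclusions (1) and (2) *)

Lemma dc_walk_le n (X : G -> Prop) b :
  (forall x, ~ X x -> coset_prob (cent x) n 1%g <= b) ->
  dc_walk mu s n <= b + (1 - b) * walk_mean n (fun t => ind (X t)).
Proof.
move=> hb; rewrite dc_walkE -walk_meanZ -[X in X + _](walk_mean_cst n) -walk_meanD.
apply: walk_mean_le => t; have [Xt|nXt] := pselect (X t).
  rewrite [X in _ * X]indT// mulr1 addrC subrK -(walk_mean_cst n 1).
  by apply: walk_mean_le => u; apply: ind_le1.
rewrite [X in _ * X]indF// mulr0 addr0; apply: le_trans (hb t nXt).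
by apply: walk_mean_le => u; rewrite invg1 mul1g.
Qed.

Lemma dc_walk_ge0 n : 0 <= dc_walk mu s n.
Proof.
rewrite dc_walkE -(walk_mean_cst n 0); apply: walk_mean_le => t.
rewrite -(walk_mean_cst n 0); apply: walk_mean_le => u; exact: ind_ge0.
Qed.

Lemma dc_walk_le1 n : dc_walk mu s n <= 1.
Proof.
rewrite dc_walkE -(walk_mean_cst n 1); apply: walk_mean_le => t.
rewrite -(walk_mean_cst n 1); apply: walk_mean_le => u; exact: ind_le1.
Qed.

Lemma dc_M_often b N : b < dc_M mu s ->
  exists n, (N <= n)%N /\ b < dc_walk mu s n.
Proof.
move=> hb; apply: contrapT => ne.
pose u n := dc_walk mu s n.+1.
have ubd : bounded_fun u.
  exists 1; split; first exact: num_real.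
  move=> x x1 n _; rewrite /= ger0_norm ?dc_walk_ge0//.
  exact: le_trans (dc_walk_le1 _) (ltW x1).
have : dc_M mu s <= b; last by rewrite leNgt hb.
rewrite /dc_M limn_supE//.
have lb : has_lbound (range (sups u)) by exact: bounded_fun_has_lbound_sups.
apply: le_trans (ge_inf lb _) _; first by exists N.
apply: ge_sup; first by exists (u N), N => /=.
move=> _ [n /= Nn <-]; rewrite leNgt; apply/negP => h; apply: ne.
by exists n.+1; split=> //; apply: leqW.
Qed.

Lemma index_lt_of_prob m (a : R) : m.+1%:R^-1 < a -> exists N, forall n, (N <= n)%N ->
  forall H, is_subgroup H -> a <= walk_mean n (fun t => ind (H t)) ->
  idx (@full G) H m.
Proof.
(* Half the gap is used, so that the bound on coset probabilities stays strictly below [a]. *)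
move=> ma; have [|N hN] := @coset_prob_index m ((a - m.+1%:R^-1) / 2).
  by rewrite divr_gt0// subr_gt0.
exists N => n Nn H sH ha; apply: contrapT => nidx.
have := hN n Nn H sH nidx 1%g; rewrite leNgt => /negP; apply.
have <- : walk_mean n (fun t => ind (H t)) = coset_prob H n 1%g.
  by apply: walk_mean_ext => t; rewrite invg1 mul1g.
by move: ma ha; move: (m.+1%:R^-1) (walk_mean _ _) => v w; lra.
Qed.

Lemma centre_subgroup : is_subgroup (@centre G).
Proof.
split=> [g|x y hx hy g|x hx g]; first by rewrite mulg1 mul1g.
  by rewrite -mulgA hy !mulgA hx.
by apply: (mulgI x); rewrite mulVKg mulgA hx mulgK.
Qed.

(* Outside the centre, centralisers have index at least 2. *)
Lemma dc_walk_centre (delta : R) : 0 < delta -> exists N, forall n, (N <= n)%N ->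
  dc_walk mu s n <= 1 / 2 + delta +
    (1 - (1 / 2 + delta)) * walk_mean n (fun t => ind (centre t)).
Proof.
move=> d0; have [N hN] := coset_prob_index 1 d0.
exists N => n Nn; apply: dc_walk_le => x nx.
rewrite div1r; apply: hN => //; first exact: cent_subgroup.
move=> ix; apply: nx => g; apply: contrapT => ng.
have /= : (size [:: 1; g]%g <= 1)%N; last by [].
apply: ix => //=; rewrite !andbT.
by apply/asboolP; rewrite invg1 mul1g.
Qed.

(** If the centre has mass [p], the degree is at most about [1/2 + p/2]; exceeding [5/8] forces
    [p > 1/4], hence index at most 3. A noncommuting pair would put [1], [x], [y], [x * y] in four
    cosets of the centre. *)
Lemma dc_gt58_abelian : 5 / 8 < dc_M mu s -> forall x y : G, (x * y = y * x)%g.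
Proof.
move=> hdc; suff i3 : idx (@full G) (@centre G) 3.
  move=> x y; apply: contrapT => nxy.
  have /= : (size [:: 1; x; y; x * y]%g <= 3)%N; last by [].
  have nx : ~ centre x by move=> /(_ y).
  have ny : ~ centre y by move=> /(_ x) /esym.
  have nc a b : ~ centre (a^-1 * b)%g -> noncong (@centre G) a b.
    by move=> h; apply/asboolP.
  apply: i3 => //; rewrite /= !nc//; rewrite ?invg1 ?mul1g ?mulKg//.
  - move=> /(_ y) e; apply: nxy; apply: (mulgI y^-1%g).
    by apply: (mulIg y); rewrite e !mulgA mulVg mul1g mulgV mul1g.
  - move=> /(_ x) e; apply: nxy; apply: (mulgI x^-1%g).
    by rewrite mulKg [RHS]mulgA e mulVKg.
  - by move=> /(_ x) e; apply: nxy; apply: (mulgI x); rewrite -e mulgA.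
have [|N1 h1] := @dc_walk_centre ((dc_M mu s - 5 / 8) / 4).
  by rewrite divr_gt0// subr_gt0.
have [|N2 h2] := @index_lt_of_prob 3 (1 / 4 + (dc_M mu s - 5 / 8) / 4).
  by rewrite div1r ltrDl divr_gt0// subr_gt0.
have [|n [nN hn]] := @dc_M_often (dc_M mu s - (dc_M mu s - 5 / 8) / 4) (maxn N1 N2).
  by rewrite ltrBlDr ltrDl divr_gt0// subr_gt0.
move: nN; rewrite geq_max => /andP[n1 n2].
apply: (h2 n n2 _ centre_subgroup).
have := h1 n n1; have := dc_walk_le1 n; move: hdc hn.
set p := walk_mean _ _; set D := dc_M _ _; set d := dc_walk _ _ _.
have p1 : p <= 1.
  by rewrite -(walk_mean_cst n 1); apply: walk_mean_le => t; apply: ind_le1.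
have p0 : 0 <= p.
  by rewrite -(walk_mean_cst n 0); apply: walk_mean_le => t; apply: ind_ge0.
move=> hD hd d1 hp; nra.
Qed.

Lemma dc_centre_index (eps : R) : 0 < eps -> 1 / 2 + eps <= dc_M mu s ->
  exists m : nat, m%:R <= eps^-1 /\ index_le (@centre G) m.
Proof.
(* An index above this [m] would bound the mass of the centre by about [1/(m+1) < eps], whereas the
   degree forces that mass to exceed [eps]. *)
move=> e0 hdc; exists (Num.truncn eps^-1).
have ei0 : 0 < eps^-1 by rewrite invr_gt0.
split; first by rewrite truncn_le ltW.
apply/(index_leP _ centre_subgroup).
set m := Num.truncn _.
have m_eps : m.+1%:R^-1 < eps.
  by rewrite invf_plt ?posrE ?ltr0n//; apply: truncnS_gt.
have [N2 h2] := index_lt_of_prob m_eps.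
have [|N1 h1] := @dc_walk_centre (eps / 4); first by rewrite divr_gt0.
have [|n [nN hn]] := @dc_M_often (1 / 2 + eps * 3 / 4) (maxn N1 N2).
  by apply: lt_le_trans hdc; lra.
move: nN; rewrite geq_max => /andP[n1 n2].
apply: (h2 n n2 _ centre_subgroup).
have := h1 n n1; have := dc_walk_le1 n; move: hn.
set p := walk_mean _ _; set d := dc_walk _ _ _.
have p1 : p <= 1.
  by rewrite -(walk_mean_cst n 1); apply: walk_mean_le => t; apply: ind_le1.
have p0 : 0 <= p.
  by rewrite -(walk_mean_cst n 0); apply: walk_mean_le => t; apply: ind_ge0.
move=> hd d1 hp; nra.
Qed.

(** * Abundance of elements with few conjugates *)

Lemma walk_mean_le_supp n phi psi :
  (forall t, t \in walk_supp s n -> phi t <= psi t) -> E n phi <= E n psi.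
Proof.
move=> h.
have -> : E n phi = E n (fun t => if t \in walk_supp s n then phi t else psi t).
  by rewrite /E big_seq [RHS]big_seq; apply: eq_bigr => t ->.
by apply: walk_mean_le => t; case: ifP => // /h.
Qed.

(** With [k = 4 * A * A.+1], the gap [1/A - 1/(A+1)] equals [4/k]: elements with more than [k]
    conjugates cost at most [2/k], passing from the limsup to a time costs [1/k], and [1/k] is the
    margin kept. *)
Lemma dense_often A : (0 < A)%N -> A%:R^-1 <= dc_M mu s -> forall N,
  exists n, (N <= n)%N /\ A.+1%:R^-1 + (4 * A * A.+1)%:R^-1 <=
    E n (fun t => ind (fcc (4 * A * A.+1) t)).
Proof.
move=> A0 hA N; set k := (4 * A * A.+1)%N; pose d : R := k%:R^-1.
have k0 : 0 < k%:R :> R by rewrite ltr0n /k !muln_gt0 A0.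
have d0 : 0 < d by rewrite invr_gt0.
have AR : 0 < A%:R :> R by rewrite ltr0n.
have dE : A%:R^-1 - A.+1%:R^-1 = 4 * d.
  rewrite /d /k !natrM -!natr1; field.
  by rewrite natr1 !pnatr_eq0 -!lt0n A0.
have [N1 h1] := coset_prob_index k d0.
have [|n [nN hn]] := @dc_M_often (A%:R^-1 - d) (maxn N N1).
  by apply: lt_le_trans hA; rewrite ltrBlDr ltrDl.
move: nN; rewrite geq_max => /andP[nN n1]; exists n; split=> //.
have hb x : ~ fcc k x -> coset_prob (cent x) n 1%g <= 2 * d.
  move=> nx; apply: le_trans (h1 n n1 _ (cent_subgroup x) nx 1%g) _.
  rewrite mulrDl mul1r lerD2r lef_pV2 ?posrE ?ler_nat ?ltr0n//.
  by rewrite -(ltr0n R).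
have := dc_walk_le hb; set p := walk_mean _ _ => hdc.
have p0 : 0 <= p.
  by rewrite -(walk_mean_cst n 0); apply: walk_mean_le => t; apply: ind_ge0.
rewrite -/d; move: dE hdc hn; set a := A%:R^-1; set b := A.+1%:R^-1 => dE hdc hn.
by nra.
Qed.

(* Each coset of [Z] has small measure, so a set [X] of measure at least [b]
   meets many of them, and few translates of [X Z] can be disjoint. *)
Lemma disjoint_translates (X Z : G -> Prop) M (b : R) :
  is_subgroup Z -> idx (@full G) Z M ->
  (forall N, exists n, (N <= n)%N /\ b <= E n (fun t => ind (X t))) ->
  let P g := exists x z, [/\ X x, Z z & g = x * z]%g in
  forall gs : seq G, pairwise (fun g h => `[< forall x y, P x -> P y ->
     g * x <> h * y >])%g gs -> b * (size gs)%:R <= 2.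
Proof.
move=> sZ iZ dense P gs disj; have [Z1 ZM ZV] := sZ.
have [rr [_ prr cov iq _]] := idx_reps sZ iZ.
have [q sq] : exists q, size rr = q.+1.
  have [a + _] := cov 1%g I; case: (rr) => // c l _.
  by exists (size l).
have nq : ~ idx (@full G) Z q.
  by move=> /(_ rr (fun _ _ => I) prr); rewrite sq ltnn.
have q0 : 0 < q.+1%:R :> R by rewrite ltr0n.
have qi0 : 0 < q.+1%:R^-1 :> R by rewrite invr_gt0.
have [N hN] := coset_prob_index q qi0.
have [n [Nn hb]] := dense N.
pose good a := `[< exists2 z, Z z & X (a * z)%g >].
(* Representatives of the cosets of [Z] that meet [X], whose union is [P]. Each has mass at most
   [2/(q+1)], so there are at least [b * (q+1) / 2] of them. *)
pose rg := [seq a <- rr | good a].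
have brg : b <= (size rg)%:R * (2 / q.+1%:R).
  apply: le_trans hb _.
  apply: (@le_trans _ _ (\sum_(a <- rg) coset_prob Z n a)).
    rewrite /coset_prob -walk_mean_sum; apply: walk_mean_le => t.
    have [Xt|nXt] := pselect (X t); last first.
      by rewrite indF// sumr_ge0// => a _; apply: ind_ge0.
    have [a ar Za] := cov t I.
    have arg : a \in rg.
      rewrite mem_filter ar andbT; apply/asboolP.
      by exists (a^-1 * t)%g; rewrite ?mulVKg.
    rewrite indT// (big_rem _ arg) /= indT// lerDl.
    by apply: sumr_ge0 => c _; apply: ind_ge0.
  rewrite mulr_natl -iter_addr_0 -[size rg]count_predT -big_const_seq.
  by apply: ler_sum => a _; rewrite mulrDl mul1r; apply: hN.
(* Disjoint translates of [P] consist of different cosets of [Z], of which there are only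
   [q + 1]. *)
have size_gs : (size gs * size rg <= q.+1)%N.
  rewrite -sq -(size_allpairs (fun g a => g * a)%g); apply: iq => //.
  elim: gs disj => //= g gs IH /andP[/allP dg /IH{}IH].
  rewrite pairwise_cat IH andbT; apply/andP; split; last first.
    rewrite pairwise_map.
    have : pairwise (noncong Z) rg by apply: subseq_pairwise prr; apply: filter_subseq.
    apply: sub_pairwise => u v /asboolP h; apply/asboolP => /=.
    by rewrite invgM -mulgA mulKg.
  apply/allrelP => _ _ /mapP[a + ->] /allpairsP[[h c] /= [hgs + ->]].
  rewrite !mem_filter => /andP[/asboolP[z Zz Xaz] _] /andP[/asboolP[z' Zz' Xcz] _].
  apply/asboolP; move=> Zac.
  have /asboolP/(_ (a * ((g * a)^-1 * (h * c)))%g c) := dg h hgs; apply.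
  - exists (a * z)%g, (z^-1 * ((g * a)^-1 * (h * c)))%g; split=> //.
      by apply: (ZM) => //; apply: ZV.
    by rewrite !mulgA mulgK.
  - by exists (c * z')%g, z'^-1%g; split=> //; [apply: ZV|rewrite mulgK].
  - by rewrite invgM !mulgA mulgK mulgV mul1g.
have : (size gs)%:R * (size rg)%:R <= q.+1%:R :> R by rewrite -natrM ler_nat.
move=> h1; have := ler_wpM2r (ler0n R (size gs)) brg => /le_trans; apply.
rewrite mulrAC mulrA [_ * 2]mulrC -mulrA -[leRHS]mulr1 ler_pM2l//.
by rewrite ler_pdivrMr// mul1r mulrC.
Qed.

(** The finite part [F] of [X] seen at one time has mass above [1/(A+1)], so it generates a subgroup
    of index at most [A], and elements centralising [F] have at most [A] conjugates. Hence [P] lies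
    in [fcc k], and at most [2 * A.+1] of its translates are disjoint. *)
Lemma dense_fcc_structure A : (0 < A)%N -> A%:R^-1 <= dc_M mu s ->
  let k := (4 * A * A.+1 * A)%N in
  idx (@full G) (generated (fcc k)) A /\
  forall g : G, generated (fcc k) g -> word (fcc k) (6 * A + 8) g.
Proof.
move=> A0 hA k; have dense := dense_often A0 hA.
set k0 := (4 * A * A.+1)%N in dense; set b := _ + _ in dense.
have k00 : (0 < k0)%N by rewrite /k0 !muln_gt0 A0.
have b_gt : A.+1%:R^-1 < b by rewrite ltrDl invr_gt0 ltr0n.
have [N1 h1] := index_lt_of_prob b_gt.
have [n [n1 hn]] := dense N1.
have X_Y : forall x : G, fcc k0 x -> fcc k x.
  move=> x Xx; apply: idx_sub Xx => //.
  by rewrite /k leq_pmulr.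
pose F := [seq x <- walk_supp s n | `[< fcc k0 x >]].
pose S := generated (fun x => x \in F).
have iS : idx (@full G) S A.
  apply: (h1 n n1 _ (generated_subgroup _)); apply: le_trans hn _.
  apply: walk_mean_le_supp => t tn; apply: ind_le => Xt.
  by apply: gen_in; rewrite mem_filter tn andbT; apply/asboolP.
split.
  apply: idx_sub iS => // x; apply: generated_min.
    exact: generated_subgroup.
  by move=> y; rewrite mem_filter => /andP[/asboolP Xy _]; apply/gen_in/X_Y.
have iZ : idx (@full G) (centl F) (k0 ^ size F)%N.
  by apply: idx_centl => x; rewrite mem_filter => /andP[/asboolP].
have Zk z : centl F z -> fcc A z.
  move=> Fz; apply: idx_sub iS => // g; apply: generated_min.
    exact: cent_subgroup.
  by move=> x xF; apply/cent_sym/Fz.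
have := disjoint_translates (centl_subgroup F) iZ dense.
set P := (P in let P := P in _) => /= trans g Yg.
have -> : (6 * A + 8 = 3 * (2 * A.+1) + 2)%N by lia.
apply: (bounded_generation (P := P)) Yg.
- by move=> _ [x [z [Xx /Zk Az ->]]]; apply: fccM.
- by move=> y; apply: fccV.
- move=> gs /trans h; rewrite -(ler_nat R).
  have : A.+1%:R^-1 * (size gs)%:R <= 2 :> R.
    by apply: le_trans h; apply: ler_wpM2r => //; apply: ltW.
  by rewrite mulrC ler_pdivrMr ?ltr0n// natrM.
Qed.
End Walk.

(** * Normality of the derived subgroup *)

Section DerivedSubgroup.
Variable G : groupType.
Local Open Scope group_scope.

Lemma generated_normal (Y : G -> Prop) :
  (forall y g, Y y -> Y (y ^ g)) -> is_normal (generated Y).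
Proof.
move=> YJ; split; first exact: generated_subgroup.
move=> x g; rewrite -mulgA -/(conjg x g); elim=> [|y Yy|y z _ hy _ hz|y _ hy].
- by rewrite conj1g; apply: gen_one.
- exact/gen_in/YJ.
- by rewrite conjMg; apply: gen_mul.
- by rewrite conjVg; apply: gen_inv.
Qed.

Lemma derived_sub (L : G -> Prop) x : is_subgroup L -> derived L x -> L x.
Proof.
move=> sL; apply: generated_min => // _ [u [v [Lu Lv ->]]].
exact: subgroupR.
Qed.

Lemma derived_normal (L : G -> Prop) : is_normal L -> is_normal (derived L).
Proof.
move=> [_ LJ]; apply: generated_normal => _ g [u [v [Lu Lv ->]]].
exists (u ^ g), (v ^ g); rewrite conjRg; split=> //;
  by rewrite /conjg mulgA; apply: LJ.
Qed.
End DerivedSubgroup.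

(** * Numerical estimates *)

Lemma derived_bound_le A k n p q m : (0 < A)%N -> k = (4 * A * A.+1 * A)%N ->
  n = (k ^ (6 * A + 8))%N -> (2 ^ p <= n)%N -> (2 ^ q <= n ^ p)%N ->
  (m <= ((k * n) * (k * n)) ^ ((6 * A + 8 + q) * (k * k)))%N ->
  (m <= 2 ^ ((2 ^ 9 * A ^ 2) * (2 ^ 15 * A ^ 4 * (2 ^ 6 * A ^ 6))))%N.
Proof.
move=> A0 kE nE hp hq hm.
(* All bounds are read off exponents of 2: [n] has exponent [O(A^2)], so [p = O(A^2)] and
   [q = O(A^4)], and [k * k = O(A^6)]; the total exponent is [O(A^12)]. *)
have A2 : (A <= 2 ^ A)%N by rewrite ltnW// ltn_expl.
have k8 : (k <= 2 ^ 3 * A ^ 3)%N.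
  rewrite kE -![(A ^ 3)%N]/(A * (A * A))%N; nia.
have k2 : (k <= 2 ^ (6 * A))%N.
  apply: leq_trans k8 _; have -> : (6 * A = 3 * A + A * 3)%N by lia.
  rewrite expnD leq_mul//; first by rewrite leq_pexp2l// leq_pmulr.
  by rewrite expnM leq_exp2r.
have n2 : (n <= 2 ^ (2 ^ 7 * A ^ 2))%N.
  rewrite nE; apply: (@leq_trans ((2 ^ (6 * A)) ^ (6 * A + 8))).
    by rewrite leq_exp2r// addn_gt0 orbT.
  rewrite -expnM leq_pexp2l//; nia.
have p2 : (p <= 2 ^ 7 * A ^ 2)%N.
  by rewrite -(@leq_exp2l 2)//; apply: leq_trans n2.
have q2 : (q <= 2 ^ 14 * A ^ 4)%N.
  rewrite -(@leq_exp2l 2)//; apply: leq_trans hq _.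
  apply: (@leq_trans ((2 ^ (2 ^ 7 * A ^ 2)) ^ p)).
    by case: (p) => // p'; rewrite leq_exp2r.
  rewrite -expnM leq_pexp2l//.
  have -> : (2 ^ 14 * A ^ 4 = (2 ^ 7 * A ^ 2) * (2 ^ 7 * A ^ 2))%N.
    by rewrite mulnACA -!expnD.
  by rewrite leq_mul2l p2 orbT.
apply: leq_trans hm _; rewrite [leqRHS]expnM.
have base : (k * n * (k * n) <= 2 ^ (2 ^ 9 * A ^ 2))%N.
  apply: (@leq_trans (2 ^ (6 * A + 2 ^ 7 * A ^ 2) * 2 ^ (6 * A + 2 ^ 7 * A ^ 2))).
    by apply: leq_mul; rewrite expnD leq_mul.
  rewrite -expnD leq_pexp2l//; nia.
have expo : ((6 * A + 8 + q) * (k * k) <= 2 ^ 15 * A ^ 4 * (2 ^ 6 * A ^ 6))%N.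
  apply: leq_mul.
    apply: (@leq_trans (14 * A ^ 4 + 2 ^ 14 * A ^ 4)).
      apply: leq_add => //.
      have : (A <= A ^ 4)%N by rewrite -{1}(expn1 A) leq_pexp2l.
      by move: A0; move: (A ^ 4)%N => B; lia.
    by rewrite -mulnDl leq_mul2r; apply/orP; right.
  have -> : (2 ^ 6 * A ^ 6 = (2 ^ 3 * A ^ 3) * (2 ^ 3 * A ^ 3))%N.
    by rewrite mulnACA -!expnD.
  exact: leq_mul.
apply: (@leq_trans ((2 ^ (2 ^ 9 * A ^ 2)) ^ ((6 * A + 8 + q) * (k * k)))).
  case: ((6 * A + 8 + q) * (k * k))%N => // e; by rewrite leq_exp2r.
by rewrite leq_pexp2l// expn_gt0.
Qed.

Section ExpBound.
Variable R : realType.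
Local Open Scope ring_scope.

(** The exponent is [2^30 * A^12], at most [2^42 * alpha^-12]. As [alpha <= 1], the power 12 may be
    raised to [2^42], so one constant serves as factor and as exponent. *)
Lemma exp_bound (alpha : R) A m : 0 < alpha -> alpha <= 1 ->
  A%:R <= 2 * alpha^-1 ->
  (m <= 2 ^ ((2 ^ 9 * A ^ 2) * (2 ^ 15 * A ^ 4 * (2 ^ 6 * A ^ 6))))%N ->
  m%:R <= expR (2 ^+ 42 * alpha `^ (- 2 ^+ 42)).
Proof.
move=> a0 a1 hA; set e := (X in (2 ^ X)%N) => hm.
apply: (@le_trans _ _ (expR 1 ^+ e)).
  apply: (@le_trans _ _ (2 ^+ e)); first by rewrite -natrX ler_nat.
  by rewrite lerXn2r ?nnegrE ?expR_ge0// (le_trans _ (expR_ge1Dx 1)).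
rewrite -expRM_natl mulr1 ler_expR.
have -> : e%:R = 2 ^+ 30 * A%:R ^+ 12 :> R.
  have -> : e = (2 ^ 30 * A ^ 12)%N.
    by rewrite /e [X in (_ * X)%N]mulnACA mulnACA -!expnD.
  by rewrite natrM !natrX.
apply: (@le_trans _ _ (2 ^+ 30 * (2 * alpha^-1) ^+ 12)).
  by rewrite ler_pM2l ?exprn_gt0// lerXn2r// nnegrE ?mulr_ge0// invr_ge0 ltW.
rewrite exprMn mulrA -exprD ler_pM2l ?exprn_gt0//.
rewrite exprVn powRN lef_pV2 ?posrE ?powR_gt0 ?exprn_gt0//.
rewrite -(powR_mulrn 12 (ltW a0)).
apply: ger_powR; first by rewrite a0.
apply: (@le_trans _ _ (2 ^+ 4)); last by rewrite ler_weXn2l// ler1n.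
by rewrite -natrX ler_nat.
Qed.
End ExpBound.

(** * Structure of groups with large degree of commutativity *)

Local Open Scope ring_scope.

Theorem theorem1p6 (R : realType) :
  exists C : R, 0 < C /\
  forall (G : groupType) (mu : G -> R) (s : seq G),
    uniq s ->
    (forall x, (x \in s) = (mu x != 0)) ->
    (forall x, 0 <= mu x) ->
    \sum_(x <- s) mu x = 1 ->
    (forall x, mu x = mu (x^-1)%g) ->
    (forall g, generated (fun x => x \in s) g) ->
    0 < mu 1%g ->
    [/\ (5 / 8 < dc_M mu s -> forall x y : G, (x * y = y * x)%g),
        (forall eps : R, 0 < eps -> 1 / 2 + eps <= dc_M mu s ->
           exists m : nat, m%:R <= eps^-1 /\ index_le (@centre G) m)
      & (forall alpha : R, 0 < alpha -> alpha <= dc_M mu s ->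
           exists (Gam H : G -> Prop),
             [/\ is_normal Gam, is_normal H,
                 index_le Gam `|Num.ceil (alpha^-1)|%N,
                 (exists t : seq G, (size t)%:R <= expR (C * alpha `^ (- C))
                                    /\ forall h, H h -> h \in t)
               & (forall h, H h -> Gam h) /\ (forall x y, Gam x -> Gam y -> H [~ x, y]%g)])].
Proof.
exists (2 ^+ 42); split; first exact: exprn_gt0.
move=> G mu s us ssupp mu0 mu1 musym sgen mupos; split.
- exact: (dc_gt58_abelian ssupp mu0 mu1 musym sgen mupos).
- exact: (dc_centre_index ssupp mu0 mu1 musym sgen mupos).
move=> alpha a0 adc.
have a1 : alpha <= 1.
  rewrite leNgt; apply/negP => a1.
  have [n [_]] := dc_M_often mu0 mu1 0 (lt_le_trans a1 adc).
  by rewrite ltNge dc_walk_le1.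
set A := `|Num.ceil alpha^-1|%N.
have ai0 : 0 < alpha^-1 by rewrite invr_gt0.
have AE : A%:R = (Num.ceil alpha^-1)%:~R :> R.
  by rewrite /A -[in RHS](@gez0_abs (Num.ceil _))// ceil_ge0 (lt_trans _ ai0) ?ltrN10.
have Age : alpha^-1 <= A%:R by rewrite AE ceil_ge.
have A0 : (0 < A)%N by rewrite -(ltr0n R); apply: lt_le_trans Age.
(* The ceiling adds less than 1, which is at most [alpha^-1] because [alpha <= 1]. *)
have Ale : A%:R <= 2 * alpha^-1.
  rewrite AE; have := ceilB1_lt (alpha^-1).
  have : 1 <= alpha^-1 by rewrite invf_ge1.
  by rewrite intrB /=; lra.
have Adc : A%:R^-1 <= dc_M mu s.
  apply: le_trans adc; rewrite -[leRHS]invrK lef_pV2// posrE ltr0n//.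
have [iG wG] := dense_fcc_structure ssupp mu0 mu1 musym sgen mupos A0 Adc.
set k := (4 * A * A.+1 * A)%N in iG wG.
have k0 : (0 < k)%N by rewrite /k !muln_gt0 A0.
have [p [q [t [hp hq ht H_t]]]] := derived_bounded k0 (fun y h => h) wG.
(* The generating set is closed under conjugation, so this subgroup is normal; [H] will be its
   derived subgroup, which makes the quotient abelian. *)
pose Gam := generated (@fcc G k).
have nG : is_normal Gam by apply: generated_normal => y g; apply: fccJ.
exists Gam, (derived Gam); split=> //.
- exact: derived_normal.
- exact/(index_leP _ (generated_subgroup _)).
- exists t; split=> //.
  exact: exp_bound (derived_bound_le A0 erefl erefl hp hq ht).
- split=> [h|x y Gx Gy]; first exact: (derived_sub (generated_subgroup _)).
  by apply: gen_in; exists x, y.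
Qed.
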